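(* Let $\tau$ be any order type. Then there is a divisible ordered abelian group $G$ such that $v_GG$ admits an automorphism $\zeta$ (of ordered sets) satisfying a) $\zeta\alpha>\alpha$ for all $\alpha\in v_GG$; b) $v_GG/\!\sim_\zeta$ has order type $\tau$. Further, the power series field $K=\mathbb R((G))$ admits a strong logarithmic cross-section for $v$, giving rise to a (non-surjective) strong logarithm having principal exponential rank $\tau$.
   Context: For an ordered abelian group $G$, $G^{<0}=\{g\in G:g<0\}$; $v_G$ is its natural valuation, sending $g\ne0$ to its archimedean class, with $v_Gg<v_Gg'$ iff $|g|>n|g'|$ for all $n\in\mathbb N$; $v_GG=v_G(G\setminus\{0\})$ is a totally ordered set. For a monotone map $\varphi$ of a totally ordered set $S$ into itself, $a\sim_\varphi a'$ iff the convex hulls in $S$ of $\{a\}\cup\{\varphi^n(a):n\in\mathbb N\}$ and $\{a'\}\cup\{\varphi^n(a'):n\in\mathbb N\}$ intersect; this is an equivalence relation with convex classes, and $S/\!\sim_\varphi$ carries the induced total order. $\mathbb R((G))$ is the field of formal sums $\sum_{g\in G}c_gt^g$, $c_g\in\mathbb R$, with well-ordered support, ordered so that a nonzero series is positive iff its leading coefficient is positive. $v$ is its natural valuation, sending a nonzero series to the minimum of its support, so that $vK=G$; $R_v$ is its valuation ring. A coarsening of $v$ is a valuation $w$ of $K$ with valuation ring $R_w\supseteq R_v$; $I_w$ is the valuation ideal of $w$, and $\mathcal U_w^{>0}=\{a\in K:wa=0,\ a>0\}$. A strong logarithmic cross-section for $v$ is an embedding $h$ of the ordered group $vK=G$ in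 $(K,+,0,<)$ with $h(G)\cap R_v=\{0\}$ and $vh(g)>g$ for all $g\in G^{<0}$. A logarithm on $K$ is an embedding of ordered groups $\ell:(K^{>0},\cdot,1,<)\to(K,+,0,<)$, not necessarily surjective. It is compatible with a coarsening $w$ of $v$ if $\ell(\mathcal U_w^{>0})=R_w\cap\mathrm{im}(\ell)$ and $\ell(1+I_w)=I_w\cap\mathrm{im}(\ell)$. It is strong if $va<v\ell a$ for all $a\in K^{>0}\setminus R_v$. A cross-section $h$ gives rise to a logarithm $\ell$ if $\ell$ is compatible with $v$ and, for some group complement $\mathbf B$ of $\mathcal U_v^{>0}$ in $(K^{>0},\cdot)$, $\ell(b)=h(-vb)$ for all $b\in\mathbf B$. Let $\ell$ be such a strong logarithm. The rank $\mathcal R$ is the set of valuation rings $R_w$ of all coarsenings $w\neq v$ of $v$ (including $K$ if $v$ is nontrivial), ordered by inclusion; the exponential rank $\mathcal R_\ell$ is the subset of all $R_w\in\mathcal R$ with $\ell(\mathcal U_w^{>0})=R_w\cap\mathrm{im}(\ell)$. Put $\Gamma=v_GvK$ and let $\zeta_\ell:\Gamma\to\Gamma$ be the $\le$-preserving map given by $\zeta_\ell(v_Gva)=v_Gv\ell a$ for $a\in K^{>0}\setminus R_v$. The principal exponential rank is the subset $\mathcal R_\ell^{\mathrm{pr}}$ of $\mathcal R_\ell$ consisting of all $R_w\in\mathcal R_\ell$ such that the final segment $\{[v_Gva]_{\sim_{\zeta_\ell}}: a\in\mathcal U_w^{>0}\setminus\mathcal U_v^{>0}\}$ of $\Gamma/\!\sim_{\zeta_\ell}$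 has a smallest element; ranks are identified with their order types.
   Formalization: The principal exponential rank has order type τ when its valuation rings are ordered by reverse inclusion (with inclusion the claim fails for τ = ω₁), and the logarithm is claimed non-surjective only for nonempty τ (for empty τ, K = ℝ and every logarithm is onto). *)

(* Defs.v *)
From HB Require Import structures.
From mathcomp Require Import all_boot all_order all_algebra generic_quotient.
From mathcomp Require Import boolp classical_sets functions cardinality fsbigop.
From mathcomp Require Import reals.
Set Implicit Arguments.
Unset Strict Implicit.
Unset Printing Implicit Defensive.
Import Order.TTheory GRing.Theory Num.Theory.
Local Open Scope classical_set_scope.
Local Open Scope ring_scope.
Local Open Scope quotient_scope.


HB.mixin Record isOrderedAbelianGroup G of Num.POrderedZmodule G := {
  oag_le_total : total (<=%R : rel G);
  oag_leD2r : forall x y z : G, x <= y -> x + z <= y + z }.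

#[short(type="oagType")]
HB.structure Definition OrderedAbelianGroup :=
  { G of Num.POrderedZmodule G & isOrderedAbelianGroup G }.

Section OagTheory.
Variable G : oagType.
Implicit Types x y z : G.

Lemma oag_comparable x y : x >=< y.
Proof. exact: oag_le_total. Qed.
Hint Resolve oag_comparable : core.

Lemma oag_ltP x y : x < y \/ y <= x.
Proof. by have [|] := comparable_ltP (oag_comparable x y); [left|right]. Qed.

Lemma oag_leNgt x y : (x <= y) = ~~ (y < x).
Proof. exact: comparable_leNgt. Qed.

Lemma oag_ltNge x y : (x < y) = ~~ (y <= x).
Proof. exact: comparable_ltNge. Qed.

Lemma oag_ge_min z x y : (Num.min x y <= z) = (x <= z) || (y <= z).
Proof. exact: comparable_ge_min. Qed.

Lemma oag_leD2 z x y : (x + z <= y + z) = (x <= y).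
Proof.
apply/idP/idP; last exact: oag_leD2r.
by move=> /(@oag_leD2r G _ _ (- z)); rewrite !addrK.
Qed.

Lemma oag_ltD2 z x y : (x + z < y + z) = (x < y).
Proof. by rewrite !oag_ltNge oag_leD2. Qed.

Lemma oag_leD x y z t : x <= y -> z <= t -> x + z <= y + t.
Proof.
move=> xy zt; apply: (le_trans (y := y + z)); first by rewrite oag_leD2.
by rewrite ![y + _]addrC oag_leD2.
Qed.

Lemma oag_leN x y : (- x <= - y) = (y <= x).
Proof. by rewrite -[LHS](oag_leD2 (x + y)) addKr [x + y]addrC addKr. Qed.

Lemma oag_leB z x y : (z - x <= z - y) = (y <= x).
Proof. by rewrite ![z - _]addrC oag_leD2 oag_leN. Qed.

Definition oag_abs x : G := Num.max x (- x).

Lemma oag_abs_ge0 x : 0 <= oag_abs x.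
Proof.
have [x0|] := oag_ltP x 0; rewrite /oag_abs.
  by rewrite comparable_le_max // -[in 0 <= - x]oppr0 oag_leN (ltW x0) orbT.
by move=> x0; rewrite comparable_le_max // x0.
Qed.

Lemma oag_leMn n x y : x <= y -> x *+ n <= y *+ n.
Proof.
move=> xy; elim: n => [|n IHn]; first by rewrite !mulr0n.
by rewrite !mulrS; exact: oag_leD.
Qed.

Definition divisible_group := forall n x, (0 < n)%N -> exists y, y *+ n = x.

End OagTheory.


Section NaturalValuation.
Variable G : oagType.

Definition nonzero := {x : G | x != 0}.
HB.instance Definition _ := Choice.on nonzero.
Implicit Types x y z : nonzero.

(* This is v_G x < v_G y. *)
Definition arch_lt x y :=
  forall n, oag_abs (val y) *+ n < oag_abs (val x).

Definition arch_equiv x y := `[< ~ arch_lt x y /\ ~ arch_lt y x >].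

Lemma arch_ltNP x y :
  ~ arch_lt x y <-> exists n, oag_abs (val x) <= oag_abs (val y) *+ n.
Proof.
split=> [/existsNP [n] /negP|[n le_xy] /(_ n)].
  by rewrite -oag_leNgt; exists n.
by rewrite oag_ltNge le_xy.
Qed.

Lemma arch_ltxx x : ~ arch_lt x x.
Proof. by apply/arch_ltNP; exists 1%N. Qed.

Lemma arch_ltN_trans y x z : ~ arch_lt x y -> ~ arch_lt y z -> ~ arch_lt x z.
Proof.
move=> /arch_ltNP [n xy] /arch_ltNP [m yz]; apply/arch_ltNP.
exists (m * n)%N; rewrite mulrnA; apply: le_trans xy _.
exact: oag_leMn.
Qed.

Lemma arch_lt_asym x y : arch_lt x y -> ~ arch_lt y x.
Proof.
move=> /(_ 1%N) xy /(_ 1%N) yx.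
by have := lt_trans xy yx; rewrite ltxx.
Qed.

Fact arch_equiv_class : equiv_class_of arch_equiv.
Proof.
split=> [x|x y|y x z]; first by apply/asboolP; split; exact: arch_ltxx.
  by apply/asbool_equiv_eq; split => -[].
move=> /asboolP [xy yx] /asboolP [yz zy]; apply/asboolP.
by split; apply: (@arch_ltN_trans y).
Qed.
Canonical arch_equiv_rel := EquivRelPack arch_equiv_class.

(* The set v_G G of archimedean classes. *)
Definition archClass := {eq_quot arch_equiv_rel}.
HB.instance Definition _ := Choice.on archClass.
HB.instance Definition _ := EqQuotient.on archClass.

Definition archClass_lt (A B : archClass) := `[< arch_lt (repr A) (repr B) >].
Definition archClass_le (A B : archClass) := ~~ archClass_lt B A.

Fact archClass_le_refl : reflexive archClass_le.
Proof. by move=> A; apply/asboolPn; exact: arch_ltxx. Qed.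

Fact archClass_le_anti : antisymmetric archClass_le.
Proof.
move=> A B /andP[/asboolPn AB /asboolPn BA]; rewrite -[A]reprK -[B]reprK.
by apply/eqmodP/asboolP.
Qed.

Fact archClass_le_trans : transitive archClass_le.
Proof.
move=> B A C /asboolPn BA /asboolPn CB; apply/asboolPn.
exact: arch_ltN_trans CB BA.
Qed.

Fact archClass_le_total : total archClass_le.
Proof.
move=> A B; rewrite -negb_and; apply/negP => /andP[/asboolP BA /asboolP].
exact: arch_lt_asym.
Qed.

Fact archClass_lt_def A B : archClass_lt A B = (B != A) && archClass_le A B.
Proof.
have [->|BA] /= := eqVneq B A; first by apply/asboolPn; exact: arch_ltxx.
apply/idP/idP => [/asboolP AB|AB].
  by apply/asboolPn; exact: arch_lt_asym.
apply: contrapT => nAB; move/eqP: BA; apply; apply: archClass_le_anti.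
by rewrite AB andbT; apply/negP.
Qed.

Fact archClass_display : Order.disp_t. Proof. exact: (Order.Disp tt tt). Qed.

HB.instance Definition _ := Order.isPOrder.Build archClass_display archClass
  archClass_lt_def archClass_le_refl archClass_le_anti archClass_le_trans.
HB.instance Definition _ := Order.POrder_isTotal.Build archClass_display archClass
  archClass_le_total.

Lemma pi_arch_lt x y :
  (\pi_archClass x < \pi_archClass y)%O <-> arch_lt x y.
Proof.
have repr_equiv z : arch_equiv (repr (\pi_archClass z)) z.
  by apply/(@eqmodP _ arch_equiv_rel); rewrite reprK.
have /asboolP [xx' x'x] := repr_equiv x; have /asboolP [yy' y'y] := repr_equiv y.
split=> [/asboolP lt_xy|lt_xy]; last apply/asboolP; apply: contrapT => nlt.
  by apply: (@arch_ltN_trans x _ _ xx' (@arch_ltN_trans y _ _ nlt y'y)).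
by apply: (@arch_ltN_trans (repr (\pi x)) _ _ x'x (@arch_ltN_trans (repr (\pi y)) _ _ nlt yy')).
Qed.

(* The natural valuation v_G; [None] is the value v_G 0 = infinity. *)
Definition natval (g : G) : option archClass :=
  omap \pi_archClass (insub g : option nonzero).

End NaturalValuation.


Section WellOrdered.
Variable G : oagType.
Implicit Types A B C : set G.

Definition well_ordered A :=
  forall B, B `<=` A -> B !=set0 -> exists2 m, B m & forall x, B x -> m <= x.

Lemma well_ordered_sub A B : A `<=` B -> well_ordered B -> well_ordered A.
Proof. by move=> AB wB C CA; apply: wB; apply: subset_trans AB. Qed.

Lemma well_orderedU A B :
  well_ordered A -> well_ordered B -> well_ordered (A `|` B).
Proof.
move=> wA wB C CAB C0.
have [CA0|CA0] := eqVneq (C `&` A) set0.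
  apply: wB => // x Cx; have [Ax|//] := CAB x Cx.
  by have : (C `&` A) x by []; rewrite CA0.
have [CB0|CB0] := eqVneq (C `&` B) set0.
  apply: wA => // x Cx; have [//|Bx] := CAB x Cx.
  by have : (C `&` B) x by []; rewrite CB0.
have [a [Ca Aa] ha] := wA _ (@subIsetr _ C A) ((set0P _).1 CA0).
have [b [Cb Bb] hb] := wB _ (@subIsetr _ C B) ((set0P _).1 CB0).
exists (Num.min a b); first by rewrite /Num.min; case: ifP.
by move=> x Cx; rewrite oag_ge_min; have [Ax|Bx] := CAB x Cx;
  apply/orP; [left; apply: ha | right; apply: hb].
Qed.

Lemma well_ordered1 x : well_ordered [set x].
Proof.
move=> B Bx [y By]; exists x => [|z /Bx -> //].
by rewrite -(Bx y By).
Qed.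

Definition sumset A B := [set x + y | x in A & y in B].

Lemma well_ordered_sumset A B :
  well_ordered A -> well_ordered B -> well_ordered (sumset A B).
Proof.
move=> wA wB C CAB C0.
pose S (P : set G) := [set c | C c /\ exists2 a, (A a /\ P a) & B (c - a)].
pose good P := S P !=set0 -> exists2 m, S P m & forall x, S P x -> m <= x.
have step P : (forall a, A a -> P a -> good (fun x => P x /\ x < a)) -> good P.
  move=> IH [c0 [Cc0 [a0 [Aa0 Pa0] Bc0]]].
  pose D := [set b | B b /\ exists2 a, (A a /\ P a) & C (a + b)].
  have DB : D `<=` B by move=> x [].
  have D0 : D !=set0.
    by exists (c0 - a0); split => //; exists a0 => //; rewrite addrC subrK.
  have [b [Bb [a [Aa Pa] Cab]] bmin] := wB D DB D0.
  have Sab : S P (a + b).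
    by split => //; exists a => //; rewrite addrAC subrr add0r.
  have [n0|n0] := eqVneq (S (fun x => P x /\ x < a)) set0; last first.
    have [m [Cm [a1 [Aa1 [Pa1 _]] Bm]] mmin] := IH a Aa Pa ((set0P _).1 n0).
    exists (Num.min m (a + b)).
      by rewrite /Num.min; case: ifP => _ //; split=> //; exists a1.
    move=> x [Cx [a2 [Aa2 Pa2] Bx]]; rewrite oag_ge_min.
    have [a2a|aa2] := oag_ltP a2 a; apply/orP.
      by left; apply: mmin; split => //; exists a2.
    right; rewrite -[x](subrK a2) [_ + a2]addrC; apply: oag_leD => //.
    by apply: bmin; split => //; exists a2 => //; rewrite addrC subrK.
  exists (a + b) => // x [Cx [a2 [Aa2 Pa2] Bx]].
  have [a2a|aa2] := oag_ltP a2 a.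
    by have : S (fun x => P x /\ x < a) x
      by [split => //; exists a2]; rewrite n0.
  rewrite -[x](subrK a2) [_ + a2]addrC; apply: oag_leD => //.
  by apply: bmin; split => //; exists a2 => //; rewrite addrC subrK.
have all_good a : A a -> good (fun x => x < a).
  move=> Aa; apply: contrapT => nga.
  pose E := [set e | A e /\ ~ good (fun x => x < e)].
  have EA : E `<=` A by move=> x [].
  have [|e [Ae nge] emin] := wA E EA; first by exists a.
  apply: nge; apply: step => f Af fe.
  have -> : (fun x => x < e /\ x < f) = (fun x => x < f).
    apply/funext => x; apply/propext; split => [[]//|xf].
    by split => //; apply: lt_trans fe.
  apply: contrapT => ngf.
  by have := emin f (conj Af ngf); rewrite oag_leNgt fe.
have : good setT.
  apply: step => a Aa _.
  have -> : (fun x => setT x /\ x < a) = (fun x => x < a).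
    by apply/funext => x; apply/propext; split => [[]//|].
  exact: all_good.
have SC : S setT = C.
  apply/seteqP; split => [x []//|x Cx]; split => //.
  have [a Aa [b Bb <-]] := CAB _ Cx.
  by exists a => //; rewrite addrAC subrr add0r.
by rewrite /good SC; apply.
Qed.

Lemma finite_well_ordered A :
  well_ordered A ->
  (forall B, B `<=` A -> B !=set0 -> exists2 m, B m & forall x, B x -> x <= m) ->
  finite_set A.
Proof.
move=> wA rA; apply: contrapT => infA.
pose seg a := [set x | A x /\ x <= a].
pose E := [set a | A a /\ ~ finite_set (seg a)].
have A0 : A !=set0.
  by apply/set0P; apply/eqP => A0; apply: infA; rewrite A0.
have [M AM Mmax] := rA A (@subset_refl _ A) A0.
have [||e [Ae infe] emin] := wA E.
- by move=> x [].
- exists M; split => //; have -> // : seg M = A.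
  by apply/seteqP; split => [x []//|x Ax]; split => //; apply: Mmax.
apply: infe.
pose L := [set x | A x /\ x < e].
have segE : seg e = L `|` [set e].
  apply/seteqP; split => x; last by case=> [[Ax /ltW]|->].
  by case=> Ax; rewrite le_eqVlt => /orP[/eqP ->|xe]; [right|left].
rewrite segE finite_setU; split; last exact: finite_set1.
have [->|L0] := eqVneq L set0; first exact: finite_set0.
have [|f [Af fe] fmax] := rA L _ ((set0P _).1 L0); first by move=> x [].
have -> : L = seg f.
  apply/seteqP; split => [x Lx|x [Ax xf]]; first by split; [case: Lx|exact: fmax].
  by split => //; apply: le_lt_trans fe.
apply: contrapT => inff.
by have := emin f (conj Af inff); rewrite oag_leNgt fe.
Qed.

Lemma finite_decomp A B g :
  well_ordered A -> well_ordered B -> finite_set [set h | A h /\ B (g - h)].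
Proof.
move=> wA wB; apply: finite_well_ordered.
  by apply: well_ordered_sub wA => x [].
move=> C CD [x Cx].
have [||m [y Cy <-] mmin] := wB [set g - y | y in C].
- by move=> _ [y Cy <-]; case: (CD y Cy).
- by exists (g - x); exists x.
exists y => // z Cz; rewrite -(oag_leB g); apply: mmin.
by exists z.
Qed.

End WellOrdered.

Section HahnSeries.
Variables (G : oagType) (R : realType).

Record hahn := Hahn {
  hcoef :> G -> R;
  hcoefP : well_ordered [set g | hcoef g != 0] }.
Arguments hcoefP : clear implicits.

HB.instance Definition _ := gen_eqMixin hahn.
HB.instance Definition _ := gen_choiceMixin hahn.

Implicit Types a b c : hahn.

Definition hsupp a := [set g | a g != 0].

Lemma hahnP a b : a =1 b -> a = b.
Proof.
case: a b => a wa [b wb] /= /funext ab; rewrite ab in wa *.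
by congr Hahn; apply: Prop_irrelevance.
Qed.

Lemma hzero_subproof : well_ordered [set g : G | (0 : R) != 0].
Proof. by move=> B B0 [x /B0 /=]; rewrite eqxx. Qed.
Definition hzero := Hahn hzero_subproof.

Lemma hmonom_subproof (c : R) (g : G) :
  well_ordered [set h | (if h == g then c else 0) != 0].
Proof.
apply: (well_ordered_sub _ (@well_ordered1 G g)) => h /=.
by case: (h =P g) => //; rewrite eqxx.
Qed.
(* The monomial c t^g. *)
Definition hmonom (c : R) (g : G) := Hahn (@hmonom_subproof c g).
Definition hone := hmonom 1 0.

Lemma hadd_subproof a b : well_ordered [set g | a g + b g != 0].
Proof.
apply: (well_ordered_sub _ (well_orderedU (hcoefP a) (hcoefP b))) => g /=.
have [->|a0 _] := eqVneq (a g) 0; last by left.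
by rewrite add0r; right.
Qed.
Definition hadd a b := Hahn (@hadd_subproof a b).

Lemma hopp_subproof a : well_ordered [set g | - a g != 0].
Proof.
by apply: (well_ordered_sub _ (hcoefP a)) => g /=; rewrite oppr_eq0.
Qed.
Definition hopp a := Hahn (@hopp_subproof a).

Lemma hconv_supp a b g : \sum_(h \in [set: G]) a h * b (g - h) != 0 ->
  sumset (hsupp a) (hsupp b) g.
Proof.
move/(@fsbigN1 R 0 +%R G G setT (fun g h => a h * b (g - h)) g) => [h _].
rewrite mulf_eq0 negb_or => /andP[ah bh].
by exists h => //; exists (g - h) => //; rewrite addrC subrK.
Qed.

(* Each such sum has finite support, see [hmul_finite]. *)
Lemma hmul_subproof a b :
  well_ordered [set g | \sum_(h \in [set: G]) a h * b (g - h) != 0].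
Proof.
apply: (well_ordered_sub _ (well_ordered_sumset (hcoefP a) (hcoefP b))) => g /=.
exact: hconv_supp.
Qed.
Definition hmul a b := Hahn (@hmul_subproof a b).

Fact haddA : associative hadd.
Proof. by move=> a b c; apply: hahnP => g /=; rewrite addrA. Qed.
Fact haddC : commutative hadd.
Proof. by move=> a b; apply: hahnP => g /=; rewrite addrC. Qed.
Fact hadd0 : left_id hzero hadd.
Proof. by move=> a; apply: hahnP => g /=; rewrite add0r. Qed.
Fact haddN : left_inverse hzero hopp hadd.
Proof. by move=> a; apply: hahnP => g /=; rewrite addNr. Qed.

HB.instance Definition _ := GRing.isZmodule.Build hahn haddA haddC hadd0 haddN.

Lemma hmul_supp a b g : hmul a b g != 0 ->
  sumset (hsupp a) (hsupp b) g.
Proof. exact: hconv_supp. Qed.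

Lemma hmulE a b g (X : set G) :
  (forall h, a h != 0 -> b (g - h) != 0 -> X h) ->
  hmul a b g = \sum_(h \in X) a h * b (g - h).
Proof.
move=> HX; apply/esym/fsbig_widen => // h [_ nX] /=.
apply: contrapT => /eqP; rewrite mulf_eq0 negb_or => /andP[ah bh].
exact/nX/HX.
Qed.

Lemma hmul_finite a b g : finite_set [set h | hsupp a h /\ hsupp b (g - h)].
Proof. by apply: finite_decomp; apply: hcoefP. Qed.

Fact hmulC : commutative hmul.
Proof.
move=> a b; apply: hahnP => g /=.
rewrite (@reindex_fsbigT R 0 +%R _ _ (fun h => g - h)).
  by apply: eq_fsbigr => h _; rewrite subKr mulrC.
by exists (fun h => g - h) => h; rewrite subKr.
Qed.

Fact hmulA : associative hmul.
Proof.
move=> a b c; apply: hahnP => g.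
pose X := [set h | hsupp a h /\ sumset (hsupp b) (hsupp c) (g - h)].
pose M := [set m | sumset (hsupp a) (hsupp b) m /\ hsupp c (g - m)].
have finX : finite_set X.
  apply: finite_decomp; first exact: hcoefP.
  by apply: well_ordered_sumset; apply: hcoefP.
have finM : finite_set M.
  apply: finite_decomp; last exact: hcoefP.
  by apply: well_ordered_sumset; apply: hcoefP.
rewrite (@hmulE a (hmul b c) g X); last first.
  by move=> h ah /hmul_supp bch.
rewrite (@hmulE (hmul a b) c g M); last first.
  by move=> h /hmul_supp ah ch.
transitivity (\sum_(h \in X) \sum_(m \in M) a h * b (m - h) * c (g - m)).
  apply: eq_fsbigr => h; rewrite inE => -[ah _].
  rewrite (@hmulE b c (g - h) [set m - h | m in M]); last first.
    move=> k bk ck; exists (h + k); last by rewrite addrAC subrr add0r.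
    split; first by exists h => //; exists k.
    by rewrite /hsupp /= opprD addrA.
  rewrite mulr_fsumr fsbig_image; last by move=> x y _ _ /addIr.
  apply: eq_fsbigr => m _.
  by rewrite mulrA opprB addrA [g - h + h]subrK.
rewrite exchange_fsbig //; apply: eq_fsbigr => m; rewrite inE => -[_ cm].
rewrite -mulr_fsuml; congr (_ * _).
rewrite [RHS](@hmulE a b m X) // => h ah bh; split => //.
exists (m - h) => //; exists (g - m); first exact: cm.
by rewrite addrC addrA subrK.
Qed.

Fact hmonomM (c : R) (g : G) b : hmul (hmonom c g) b =1 fun h => c * b (h - g).
Proof.
move=> h; rewrite (@hmulE _ _ _ [set g]) ?fsbig_set1 /= ?eqxx //.
by move=> k; case: (k =P g) => //; rewrite eqxx.
Qed.

Fact hmul1 : left_id hone hmul.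
Proof.
by move=> a; apply: hahnP => g; rewrite hmonomM mul1r subr0.
Qed.

Fact hmulDl : left_distributive hmul hadd.
Proof.
move=> a b c; apply: hahnP => g.
pose X := [set h | hsupp a h /\ hsupp c (g - h)]
      `|` [set h | hsupp b h /\ hsupp c (g - h)].
have finX : finite_set X by rewrite finite_setU; split; exact: hmul_finite.
rewrite -[RHS]/(hmul a c g + hmul b c g).
rewrite (@hmulE (hadd a b) c g X); last first.
  move=> h /= abh ch; have [a0|a0] := eqVneq (a h) 0; last by left.
  by right; split => //; move: abh; rewrite a0 add0r.
rewrite (@hmulE a c g X); last by move=> h ah ch; left.
rewrite (@hmulE b c g X); last by move=> h ah ch; right.
rewrite -fsbig_split //; apply: eq_fsbigr => h _ /=.
by rewrite mulrDl.
Qed.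

Fact hone_neq0 : hone != 0 :> hahn.
Proof.
apply/eqP => /(congr1 (fun a : hahn => a 0)) /eqP /=.
by rewrite eqxx oner_eq0.
Qed.

HB.instance Definition _ :=
  GRing.Zmodule_isComNzRing.Build hahn hmulA hmulC hmul1 hmulDl hone_neq0.

Lemma hval_ex a : a != 0 ->
  exists2 g, a g != 0 & forall h, a h != 0 -> g <= h.
Proof.
move=> a0; apply: (hcoefP a) => //.
apply: contrapT => /forallNP an; move/eqP: a0; apply; apply: hahnP => g /=.
by apply: contrapT => /eqP ag; apply: (an g).
Qed.

(* The natural valuation of the series field: the least exponent of the
   support; [hval 0] is a junk value. *)
Definition hval a : G :=
  xget 0 [set g | a g != 0 /\ forall h, a h != 0 -> g <= h].

Lemma hvalP a : a != 0 ->
  a (hval a) != 0 /\ forall h, a h != 0 -> hval a <= h.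
Proof.
move=> /hval_ex [g ag gmin]; rewrite /hval.
by case: xgetP => [h -> //|/(_ g)]; case.
Qed.

Lemma hval_lt a h : a != 0 -> h < hval a -> a h = 0.
Proof.
move=> /hvalP [_ amin]; rewrite oag_ltNge => nle.
by apply: contrapT => /eqP /amin; rewrite (negbTE nle).
Qed.

Lemma hsub_coef a b g : (a - b) g = a g - b g.
Proof. by []. Qed.

Lemma hmul_lead a b : a != 0 -> b != 0 ->
  (a * b) (hval a + hval b) = a (hval a) * b (hval b).
Proof.
move=> a0 b0; have [_ amin] := hvalP a0; have [_ bmin] := hvalP b0.
rewrite (@hmulE a b _ [set hval a]) ?fsbig_set1 ?[_ + hval b]addrC ?addrK //.
move=> h /amin ha /bmin hb; apply/le_anti; rewrite ha andbT.
rewrite -(oag_leD2 (hval b)) [h + _]addrC.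
by move: hb; rewrite -(oag_leD2 h) subrK addrC.
Qed.

Lemma hmul_lt a b g : a != 0 -> b != 0 -> g < hval a + hval b -> (a * b) g = 0.
Proof.
move=> a0 b0; have [_ amin] := hvalP a0; have [_ bmin] := hvalP b0.
rewrite oag_ltNge => nle; apply: contrapT => /eqP /hmul_supp [h ah [k bk hk]].
by move: nle; rewrite -hk oag_leD //; [apply: amin | apply: bmin].
Qed.


Section Inverse.
Variable a : hahn.
Hypothesis a0 : a != 0.

Let approx (b : hahn) :=
  forall g h, b g != 0 -> (1 - a * b) h != 0 -> g + hval a < h.

Let trunc (b c : hahn) :=
  forall h, c h != b h -> b h = 0 /\ forall g, b g != 0 -> g < h.

Let trunc_refl b : trunc b b.
Proof. by move=> h; rewrite eqxx. Qed.

Let trunc_supp b c g : trunc b c -> b g != 0 -> c g = b g.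
Proof.
by move=> bc bg; apply: contrapT => /eqP /bc [/eqP]; rewrite (negbTE bg).
Qed.

Let trunc_trans b c d : trunc b c -> trunc c d -> trunc b d.
Proof.
move=> bc cd h dbh; have [cbh|/bc //] := eqVneq (c h) (b h).
have [|ch0 chl] := cd h; first by rewrite cbh.
split=> [|g bg]; first by rewrite -cbh.
by apply: chl; rewrite (trunc_supp bc).
Qed.

Let trunc_anti b c : trunc b c -> trunc c b -> b = c.
Proof.
move=> bc cb; apply: hahnP => h; apply: contrapT => /eqP bch.
have [ch _] := cb h bch; rewrite eq_sym in bch; have [bh _] := bc h bch.
by move: bch; rewrite ch bh eqxx.
Qed.

Section Chain.
Variable C : set hahn.
Hypothesis Capprox : forall b, C b -> approx b.
Hypothesis Ctot : forall b c, C b -> C c -> trunc b c \/ trunc c b.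

Let lim (g : G) : R := xget 0 [set x | x != 0 /\ exists2 b, C b & b g = x].

Let lim_eq b g : C b -> b g != 0 -> lim g = b g.
Proof.
move=> Cb bg; rewrite /lim; case: xgetP => [x -> [x0 [c Cc cg]]|/(_ (b g))].
  rewrite -cg in x0 *.
  by have [bc|cb] := Ctot Cb Cc; [exact: trunc_supp | rewrite (trunc_supp cb)].
by case; split => //; exists b.
Qed.

Let lim_neq0 g : lim g != 0 -> exists2 b, C b & b g != 0.
Proof.
rewrite /lim; case: xgetP => [x -> [x0 [c Cc cg]]|_]; last by rewrite eqxx.
by exists c; rewrite ?cg.
Qed.

Let lim_trunc b h : C b -> lim h != b h ->
  b h = 0 /\ forall g, b g != 0 -> g < h.
Proof.
move=> Cb lb; have [bh|bh] := eqVneq (b h) 0; last first.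
  by move: lb; rewrite (lim_eq Cb bh) eqxx.
split => // g bg; have [|c Cc ch] := @lim_neq0 h; first by rewrite -bh.
have [bc|cb] := Ctot Cb Cc; last first.
  by move: (ch); rewrite -(trunc_supp cb ch) bh eqxx.
by have [|_] := bc h; [rewrite bh|apply].
Qed.

Let lim_wo : well_ordered [set g | lim g != 0].
Proof.
move=> B Bl [x Bx]; have [b Cb bx] := lim_neq0 (Bl x Bx).
have [||m [Bm bm] mmin] := hcoefP b (B `&` hsupp b).
- by move=> y [].
- by exists x.
exists m => // y By; have [bym|bym] := eqVneq (b y) 0; last exact: mmin.
have ly := Bl y By.
by have [|_ /(_ m bm)/ltW] := @lim_trunc b y Cb; first by rewrite bym.
Qed.

Lemma chain_bound :
  exists2 c, approx c & forall b, C b -> trunc b c.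
Proof.
exists (Hahn lim_wo); last by move=> b Cb h; exact: lim_trunc.
move=> g h /lim_neq0 [b Cb bg] lh; rewrite oag_ltNge; apply/negP => hg.
suff e : (1 - a * Hahn lim_wo) h = (1 - a * b) h.
  by rewrite e in lh; have := Capprox Cb bg lh; rewrite oag_ltNge hg.
rewrite !hsub_coef; congr (_ - _); apply: eq_fsbigr => k _ /=.
have [->|ak] := eqVneq (a k) 0; first by rewrite !mul0r.
congr (_ * _); apply: contrapT => /eqP /(lim_trunc Cb) [_ /(_ g bg)].
rewrite oag_ltNge => /negP; apply.
rewrite -(oag_leD2 k) subrK; apply: le_trans hg _.
by apply: oag_leD => //; have [_ ->] := hvalP a0.
Qed.

End Chain.

Lemma hinv_ex : exists b, b * a = 1.
Proof.
pose T := {b : hahn | approx b}.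
pose S (b c : T) := `[< trunc (sval b) (sval c) >].
have [|b c d /asboolP bc /asboolP cd|b c /asboolP bc /asboolP cb||[b apb] bmax]
  := @Zorn T S.
- by move=> b; apply/asboolP; exact: trunc_refl.
- by apply/asboolP; exact: trunc_trans cd.
- case: b c bc cb => b apb [c apc] /= bc cb.
  by move: apb; rewrite (trunc_anti bc cb) => apb; congr exist; exact: Prop_irrelevance.
- move=> A Atot; have [||c apc cmax] := @chain_bound [set sval b | b in A].
  + by move=> _ [[b apb] _ <-].
  + by move=> _ _ [b Ab <-] [c Ac <-]; have [/asboolP|/asboolP] := Atot b c Ab Ac;
      [left|right].
  by exists (exist _ c apc) => b Ab; apply/asboolP/cmax; exists b.
exists b; apply/esym/eqP; rewrite mulrC -subr_eq0; apply: contrapT => /negP d0.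
set d := 1 - a * b in d0.
have [dv dmin] := hvalP d0; have [av amin] := hvalP a0.
pose k := hval d - hval a.
pose x := d (hval d) / a (hval a).
pose c := b + hmonom x k.
have bk g : b g != 0 -> g < k.
  by move=> bg; rewrite -(oag_ltD2 (hval a)) /k subrK; exact: (apb g _ bg dv).
have bk0 : b k = 0.
  by apply: contrapT => /eqP /bk; rewrite ltxx.
have x0 : x != 0 by rewrite mulf_neq0 ?invr_eq0.
have dcE h : (1 - a * c) h = d h - x * a (h - k).
  rewrite /c mulrDr opprD addrA [X in X = _]hsub_coef -/d.
  by rewrite [a * _]mulrC hmonomM.
have apc : approx c.
  move=> g h cg; rewrite dcE => dh.
  have gk : g <= k.
    move: cg => /=; case: (g =P k) => [-> //|_]; rewrite addr0 => /bk.
    exact: ltW.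
  apply: (le_lt_trans (y := hval d)).
    by rewrite -[hval d](subrK (hval a)) oag_leD2.
  have [dhl|//] := oag_ltP h (hval d); last first.
    rewrite le_eqVlt => /orP[/eqP hh|//]; move: dh.
    by rewrite -hh /k subKr /x divfK // subrr eqxx.
  move: dh; rewrite (hval_lt d0 dhl) (hval_lt (h := h - k) a0).
    by rewrite mulr0 subr0 eqxx.
  by rewrite -(oag_ltD2 k) subrK /k addrC subrK.
have bc : trunc b c.
  move=> h /=; case: (h =P k) => [->|_]; last by rewrite addr0 eqxx.
  by move=> _; split.
have /(congr1 (fun u : T => sval u k)) /= := bmax (exist _ c apc) (asboolT bc).
by rewrite eqxx bk0 add0r => /eqP; rewrite (negbTE x0).
Qed.

End Inverse.

Definition hinv a : hahn := xget 0 [set b | b * a = 1].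

Fact hmulV a : a != 0 -> hinv a * a = 1.
Proof.
move=> /hinv_ex [b ba]; rewrite /hinv.
by case: xgetP => [c -> //|/(_ b)]; case.
Qed.

Fact hinv0 : hinv 0 = 0.
Proof.
rewrite /hinv; case: xgetP => // b _ /=; rewrite mulr0 => /eqP.
by rewrite eq_sym oner_eq0.
Qed.

HB.instance Definition _ := GRing.ComNzRing_isField.Build hahn hmulV hinv0.


Definition hpos a := exists2 g, 0 < a g & forall h, h < g -> a h = 0.
Definition hlt a b := `[< hpos (b - a) >].
Definition hle a b := (a == b) || hlt a b.
Definition habs a := if hle 0 a then a else - a.

Lemma hposE a : hpos a <-> a != 0 /\ 0 < a (hval a).
Proof.
split=> [[g ag gmin]|[a0 apos]]; last first.
  by exists (hval a) => // h; exact: hval_lt.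
have a0 : a != 0 by apply/eqP => a0; move: ag; rewrite a0 ltxx.
split => //; have [av amin] := hvalP a0.
suff -> : hval a = g by [].
apply/le_anti; rewrite amin ?gt_eqF //= oag_leNgt; apply/negP => /gmin /eqP.
by rewrite (negbTE av).
Qed.

Lemma hposD a b : hpos a -> hpos b -> hpos (a + b).
Proof.
move=> [g ag gmin] [h bh hmin]; have [gh|hg] := oag_ltP g h.
  exists g => [|k kg] /=; first by rewrite hmin // addr0.
  by rewrite gmin // hmin ?addr0 //; apply: lt_trans gh.
move: hg; rewrite le_eqVlt => /orP[/eqP hg|hg].
  exists g => [|k kg] /=; first by rewrite addr_gt0 // -hg.
  by rewrite gmin // hmin ?addr0 // hg.
exists h => [|k kh] /=; first by rewrite gmin // add0r.
by rewrite gmin ?hmin ?addr0 //; apply: lt_trans hg.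
Qed.

Lemma hposM a b : hpos a -> hpos b -> hpos (a * b).
Proof.
move=> /hposE [a0 ap] /hposE [b0 bp]; exists (hval a + hval b).
  by rewrite hmul_lead // mulr_gt0.
by move=> h; exact: hmul_lt.
Qed.

Lemma hposN a : hpos a -> ~ hpos (- a).
Proof.
move=> /hposD /[apply]; rewrite subrr => -[g] /=.
by rewrite ltxx.
Qed.

Lemma hpos_total a : a != 0 -> hpos a \/ hpos (- a).
Proof.
move=> a0; have [av amin] := hvalP a0.
have [ap|an|/eqP] := ltrgtP 0 (a (hval a)); last by rewrite eq_sym (negbTE av).
  by left; apply/hposE.
right; exists (hval a) => [|h /(hval_lt a0) ah] /=; first by rewrite oppr_gt0.
by rewrite ah oppr0.
Qed.

Lemma hle0E a : hle 0 a <-> a = 0 \/ hpos a.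
Proof.
rewrite /hle /hlt subr0 eq_sym; split.
  by move=> /orP[/eqP|/asboolP]; [left|right].
by move=> [->|/asboolT ->]; rewrite ?eqxx ?orbT.
Qed.

Lemma hlexx0E a : hle a 0 <-> a = 0 \/ hpos (- a).
Proof.
rewrite /hle /hlt sub0r; split.
  by move=> /orP[/eqP|/asboolP]; [left|right].
by move=> [->|/asboolT ->]; rewrite ?eqxx ?orbT.
Qed.

Fact hle0_add a b : hle 0 a -> hle 0 b -> hle 0 (a + b).
Proof.
move=> /hle0E [->|pa] /hle0E [->|pb]; apply/hle0E; rewrite ?addr0 ?add0r;
  by [left | right | right; exact: hposD].
Qed.

Fact hle0_mul a b : hle 0 a -> hle 0 b -> hle 0 (a * b).
Proof.
move=> /hle0E [->|pa] /hle0E [->|pb]; apply/hle0E; rewrite ?mulr0 ?mul0r;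
  by [left | right | right; exact: hposM].
Qed.

Fact hle0_anti a : hle 0 a -> hle a 0 -> a = 0.
Proof. by move=> /hle0E [//|/hposN pa] /hlexx0E [//|/pa]. Qed.

Fact hsub_ge0 a b : hle 0 (b - a) = hle a b.
Proof. by rewrite /hle /hlt subr0 [0 == _]eq_sym subr_eq0 [b == a]eq_sym. Qed.

Fact hle0_total a : hle 0 a || hle a 0.
Proof.
have [->|/hpos_total [pa|pa]] := eqVneq a 0; first by rewrite /hle eqxx.
  by apply/orP; left; apply/hle0E; right.
by apply/orP; right; apply/hlexx0E; right.
Qed.

Fact habsN a : habs (- a) = habs a.
Proof.
rewrite /habs -[in hle 0 (- a)]sub0r hsub_ge0 opprK.
case: (boolP (hle a 0)) => an; case: (boolP (hle 0 a)) => ap //.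
  by rewrite (hle0_anti ap an) oppr0.
by have := hle0_total a; rewrite (negbTE an) (negbTE ap).
Qed.

Fact hge0_abs a : hle 0 a -> habs a = a.
Proof. by rewrite /habs => ->. Qed.

Fact hlt_def a b : hlt a b = (b != a) && hle a b.
Proof.
rewrite /hle [a == b]eq_sym; have [->|//] := eqVneq b a.
rewrite /hlt subrr; apply/negP => /asboolP [g] /=.
by rewrite ltxx.
Qed.

HB.instance Definition _ := Num.IntegralDomain_isLeReal.Build hahn
  hle0_add hle0_mul hle0_anti hsub_ge0 hle0_total habsN hge0_abs hlt_def.

End HahnSeries.


(* [Q], ordered by [le], is isomorphic to [T]; injectivity of [f] follows from
   the antisymmetry of [T]. *)
Definition has_order_type d (T : orderType d) (U : Type) (Q : set U)
    (le : U -> U -> Prop) :=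
  exists f : T -> U,
    range f = Q /\ forall x y, le (f x) (f y) <-> (x <= y)%O.

Section OrbitEquivalence.
Context {d : Order.disp_t} {S : orderType d}.
Variable phi : S -> S.

Definition convex_hull (A : set S) :=
  [set x | exists2 a, A a & exists2 b, A b & (a <= x <= b)%O].

Definition iter_orbit (a : S) := range (fun n => iter n phi a).

Definition orbit_sim (a b : S) :=
  (convex_hull (iter_orbit a) `&` convex_hull (iter_orbit b)) !=set0.

Definition orbit_class (a : S) : set S := [set b | orbit_sim a b].

(* S/~phi, as a set of subsets of S. *)
Definition orbit_quot : set (set S) := range orbit_class.

End OrbitEquivalence.

(* The order induced on a set of pairwise disjoint convex subsets of [S]. *)
Definition class_le d (S : orderType d) (A B : set S) :=
  exists2 a, A a & exists2 b, B b & (a <= b)%O.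

Definition has_least (U : Type) (le : U -> U -> Prop) (Q : set U) :=
  exists2 m, Q m & forall x, Q x -> le m x.

Definition order_automorphism d (S : orderType d) (z : S -> S) :=
  bijective z /\ {mono z : x y / (x <= y)%O}.


Section Valuations.
Variables (K : realFieldType) (H : oagType).

(* Valuations are only considered on nonzero elements; w 0 is a junk value
   standing for infinity. *)
Definition valuation (w : K -> H) :=
  (forall a b, a != 0 -> b != 0 -> w (a * b) = w a + w b) /\
  (forall a b, a != 0 -> b != 0 -> a + b != 0 ->
     Num.min (w a) (w b) <= w (a + b)).

Variable w : K -> H.

Definition val_ring : set K := [set a | a = 0 \/ 0 <= w a].
Definition val_ideal : set K := [set a | a = 0 \/ 0 < w a].
Definition pos_units : set K := [set a | 0 < a /\ w a = 0].

End Valuations.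


Section Logarithms.
Context {G : oagType} {R : realType}.
Local Notation K := (hahn G R).
Local Notation v := (@hval G R).
Local Notation Gamma := (archClass G).

Definition coarsening (H : oagType) (w : K -> H) :=
  valuation w /\ val_ring v `<=` val_ring w.

(* A map K -> K stands for its restriction to the positive elements. *)
Definition logarithm (l : K -> K) :=
  (forall a b, 0 < a -> 0 < b -> l (a * b) = l a + l b) /\
  (forall a b, 0 < a -> 0 < b -> a < b -> l a < l b).

Definition log_image (l : K -> K) : set K := l @` [set a | 0 < a].

Definition log_units_compatible (H : oagType) (l : K -> K) (w : K -> H) :=
  l @` pos_units w = val_ring w `&` log_image l.

Definition log_compatible (H : oagType) (l : K -> K) (w : K -> H) :=
  log_units_compatible l w /\
  l @` [set 1 + a | a in val_ideal w] = val_ideal w `&` log_image l.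

Definition strong_log (l : K -> K) :=
  forall a, 0 < a -> ~ val_ring v a -> v a < v (l a).

Definition strong_log_cross_section (h : G -> K) :=
  [/\ {morph h : x y / x + y},
      {homo h : x y / x < y},
      range h `&` val_ring v = [set 0]
    & forall g, g < 0 -> g < v (h g)].

Definition pos_complement (B U : set K) :=
  [/\ [/\ B `<=` [set a | 0 < a], B 1, {in B &, forall a b, B (a * b)}
        & {in B, forall a, B a^-1}],
      B `&` U = [set 1]
    & forall a, 0 < a -> exists2 b, B b & exists2 u, U u & a = b * u].

Definition gives_rise_to (h : G -> K) (l : K -> K) :=
  [/\ logarithm l, log_compatible l v
    & exists2 B, pos_complement B (pos_units v)
               & {in B, forall b, l b = h (- v b)}].

(* The set of valuation rings of the coarsenings w <> v of v; valuations are
   identified when their valuation rings agree.  A larger ring S gives a larger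
   final segment of Gamma, hence a smaller least class: sending a member of
   [principal_exp_rank] to its least class reverses inclusion. *)
Definition rank : set (set K) :=
  [set S | exists (H : oagType) (w : K -> H),
     [/\ coarsening w, val_ring w <> val_ring v & S = val_ring w]].

Definition exp_rank (l : K -> K) : set (set K) :=
  [set S | rank S /\ exists (H : oagType) (w : K -> H),
     [/\ coarsening w, log_units_compatible l w & S = val_ring w]].

(* z is the map zeta_l on v_G(vK). *)
Definition is_log_zeta (l : K -> K) (z : Gamma -> Gamma) :=
  {homo z : x y / (x <= y)%O} /\
  forall a, 0 < a -> ~ val_ring v a ->
    omap z (natval (v a)) = natval (v (l a)).

Definition final_classes (H : oagType) (z : Gamma -> Gamma) (w : K -> H) :
    set (set Gamma) :=
  [set C | exists a alpha, [/\ (pos_units w `\` pos_units v) a,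
     natval (v a) = Some alpha & C = orbit_class z alpha]].

Definition principal_exp_rank (l : K -> K) (z : Gamma -> Gamma) :
    set (set K) :=
  [set S | exp_rank l S /\ exists (H : oagType) (w : K -> H),
     [/\ coarsening w, has_least (@class_le _ _) (final_classes z w)
       & S = val_ring w]].

End Logarithms.

(* Main.v *)
(* Let [G] be the lexicographic sum of copies of [R] indexed by [T * Z] ordered
   lexicographically, and [zeta (t, n) = (t, n + 1)]; the classes of [zeta] are
   the fibers over [T].  The cross-section sends [sum_i g_i 1_i] to
   [sum_i g_i t^(- 1_(zeta i))].  The logarithm is
     l a = h (- v a) + ln (leading coefficient of a) + D a,
   where [D], which kills the monomials and embeds the 1-units, is built from
   logarithmic derivatives rather than from the power series of [ln (1 + x)]:
   every additive [chi : G -> R] induces the derivation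
   [sum_g c_g t^g |-> sum_g chi(g) c_g t^g], and the coefficient of [D a] at [g]
   is that of [(derivation of a) / a] for some [chi] with [chi g = 1], and [0]
   if [g = 0].  So [D] turns products into sums, because a logarithmic
   derivative does, and [D (1 + e)] has the same leading term as [e].
   The members of the principal exponential rank are the coarsenings of [v] by
   the convex subgroups of those [g] whose leading index [(s, n)] satisfies
   [t <= s]: compatibility of [l] with the units makes the kernel of a coarsening
   closed under [zeta^-1], hence a union of fibers, and the least class provides
   [t]. *)
Require Import Defs.
From HB Require Import structures.
From mathcomp Require Import all_boot all_order all_algebra generic_quotient.
From mathcomp Require Import boolp classical_sets functions cardinality fsbigop.
From mathcomp Require Import reals exp.
Set Implicit Arguments.
Unset Strict Implicit.
Unset Printing Implicit Defensive.
Import Order.TTheory GRing.Theory Num.Theory.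
Local Open Scope classical_set_scope.
Local Open Scope ring_scope.
Local Open Scope quotient_scope.

(** * Signs in ordered abelian groups *)

Section OrderedGroup.
Variable G : oagType.
Implicit Types x y z : G.

Lemma oag_neq0 x : x != 0 -> x < 0 \/ 0 < x.
Proof.
move=> x0; have [|] := oag_ltP x 0; first by left.
by rewrite le_eqVlt eq_sym (negbTE x0); right.
Qed.

Lemma oag_subr_ge0 x y : (0 <= y - x) = (x <= y).
Proof. by rewrite -[LHS](oag_leD2 x) subrK add0r. Qed.

Lemma oag_subr_gt0 x y : (0 < y - x) = (x < y).
Proof. by rewrite -[LHS](oag_ltD2 x) subrK add0r. Qed.

Lemma oag_oppr_gt0 x : (0 < - x) = (x < 0).
Proof. by rewrite -sub0r oag_subr_gt0. Qed.

Lemma oag_oppr_lt0 x : (- x < 0) = (0 < x).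
Proof. by rewrite -oag_oppr_gt0 opprK. Qed.

End OrderedGroup.

(** * Values and leading coefficients of series *)

Section HahnValuation.
Variables (G : oagType) (R : realType).
Implicit Types (a b c : hahn G R) (g p q : G).
Local Notation v := (@hval G R).

Lemma hval_eq a g : a g != 0 -> (forall q, q < g -> a q = 0) -> v a = g.
Proof.
move=> ag amin; have a0 : a != 0 by apply/eqP => a0; move: ag; rewrite a0 eqxx.
have [av vmin] := hvalP a0; apply/le_anti; rewrite vmin //=.
by rewrite oag_leNgt; apply/negP => /amin /eqP; rewrite (negbTE av).
Qed.

Lemma hval_ge a g : a != 0 -> (forall q, q < g -> a q = 0) -> g <= v a.
Proof.
move=> /hvalP [av _] amin; rewrite oag_leNgt.
by apply/negP => /amin /eqP; rewrite (negbTE av).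
Qed.

Lemma hneq0 a g : a g != 0 -> a != 0.
Proof. by move=> ag; apply/eqP => a0; move: ag; rewrite a0 eqxx. Qed.

Lemma hgt0E a : 0 < a <-> a != 0 /\ 0 < a (v a).
Proof.
rewrite -hposE; have -> : (0 < a) = `[< hpos (a - 0) >] by [].
by rewrite subr0; split => /asboolP.
Qed.

Lemma hcoef1 g : (1 : hahn G R) g = (g == 0)%:R.
Proof. by rewrite /= ; case: eqP. Qed.

Lemma hval1 : v 1 = 0.
Proof.
by apply: hval_eq => [|q q0]; rewrite hcoef1 ?eqxx ?oner_eq0 // lt_eqF.
Qed.

Lemma hvalM a b : a != 0 -> b != 0 -> v (a * b) = v a + v b.
Proof.
move=> a0 b0; apply: hval_eq; last by move=> q; exact: hmul_lt.
by rewrite hmul_lead // mulf_neq0 //; [have [] := hvalP a0|have [] := hvalP b0].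
Qed.

Lemma hvalV a : a != 0 -> v a^-1 = - v a.
Proof.
move=> a0; apply/eqP; rewrite -addr_eq0 -hvalM ?invr_eq0 //.
by rewrite mulVf // hval1.
Qed.

Lemma hvalN a : v (- a) = v a.
Proof.
have [->|a0] := eqVneq a 0; first by rewrite oppr0.
have [av _] := hvalP a0; apply: hval_eq => [|q qv]; rewrite /= ?oppr_eq0 //.
by rewrite (hval_lt a0) ?oppr0.
Qed.

Lemma hmonom_neq0 (r : R) g : r != 0 -> hmonom r g != 0.
Proof. by move=> r0; apply: (@hneq0 _ g); rewrite /= eqxx. Qed.

Lemma hval_monom (r : R) g : r != 0 -> v (hmonom r g) = g.
Proof.
by move=> r0; apply: hval_eq => [|q /lt_eqF qg] /=; rewrite ?eqxx ?qg.
Qed.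

Lemma hval_ringE a : val_ring v a <-> forall g, g < 0 -> a g = 0.
Proof.
split=> [[-> //|va g g0]|an].
  have [->//|a0] := eqVneq a 0; apply: (hval_lt a0).
  exact: lt_le_trans va.
by have [->|a0] := eqVneq a 0; [left|right; exact: hval_ge].
Qed.

Lemma hval_idealE a : val_ideal v a <-> forall g, g <= 0 -> a g = 0.
Proof.
split=> [[-> //|va g g0]|an].
  have [->//|a0] := eqVneq a 0; apply: (hval_lt a0).
  exact: le_lt_trans va.
have [->|a0] := eqVneq a 0; [by left|right].
rewrite oag_ltNge; apply/negP => /an /eqP.
by have [/negbTE ->] := hvalP a0.
Qed.

(* [p] and [q] need not be the exact values of [a] and [b]. *)
Lemma hmul_coef_low a b p q :
  (forall g, g < p -> a g = 0) -> (forall g, g < q -> b g = 0) ->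
  (forall g, g < p + q -> (a * b) g = 0) /\ (a * b) (p + q) = a p * b q.
Proof.
move=> ap bq; split=> [g gpq|].
  apply: contrapT => /eqP /hmul_supp [x ax [y by_ xy]].
  move: gpq; rewrite -xy oag_ltNge oag_leD // oag_leNgt; apply/negP => lt.
    by move: ax; rewrite /hsupp /= ap ?eqxx.
  by move: by_; rewrite /hsupp /= bq ?eqxx.
rewrite (@hmulE _ _ a b _ [set p]) ?fsbig_set1 ?[p + q]addrC ?addrK //.
move=> x ax bx; apply/le_anti; rewrite [p <= x]oag_leNgt; apply/andP; split.
  rewrite oag_leNgt; apply/negP => px; move: bx; rewrite bq ?eqxx //.
  by rewrite -(oag_ltD2 x) subrK oag_ltNge [q + x]addrC [q + p]addrC oag_leD2 -oag_ltNge.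
by apply/negP => /ap /eqP; rewrite (negbTE ax).
Qed.

Lemma hcoefV_lead a : a != 0 -> a^-1 (- v a) = (a (v a))^-1.
Proof.
move=> a0; have [av _] := hvalP a0.
have : (a * a^-1) (v a + v a^-1) = 1 by rewrite divff // hvalV // subrr hcoef1 eqxx.
by rewrite hmul_lead ?invr_eq0 // hvalV // => e; apply: (mulfI av); rewrite divff.
Qed.

End HahnValuation.

(** * The logarithm given by a cross-section *)

Section Derivation.
Variables (G : oagType) (R : realType) (chi : G -> R).
Hypothesis chiD : {morph chi : x y / x + y}.
Implicit Types a b : hahn G R.

Lemma hderiv_subproof a : well_ordered [set g | chi g * a g != 0].
Proof.
apply: (well_ordered_sub _ (@hcoefP _ _ a)) => g /=.
by rewrite mulf_eq0 negb_or => /andP[].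
Qed.
Definition hderiv a := Hahn (@hderiv_subproof a).

Lemma hderivM a b : hderiv (a * b) = hderiv a * b + a * hderiv b.
Proof.
apply: hahnP => g; pose X := [set h | hsupp a h /\ hsupp b (g - h)].
have finX : finite_set X by exact: hmul_finite.
rewrite -[LHS]/(chi g * hmul a b g).
rewrite -[RHS]/(hmul (hderiv a) b g + hmul a (hderiv b) g).
rewrite (@hmulE _ _ a b g X) // (@hmulE _ _ (hderiv a) b g X); last first.
  by move=> h /=; rewrite mulf_eq0 negb_or => /andP[].
rewrite (@hmulE _ _ a (hderiv b) g X); last first.
  by move=> h ah /=; rewrite mulf_eq0 negb_or => /andP[].
rewrite mulr_fsumr -fsbig_split //; apply: eq_fsbigr => h _ /=.
by rewrite -mulrA [a h * (chi _ * _)]mulrCA -mulrDl -chiD [h + _]addrC subrK.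
Qed.

End Derivation.

Section Logarithm.
Variables (G : oagType) (R : realType) (chi : G -> G -> R).
Hypothesis chiD : forall g, {morph chi g : x y / x + y}.
Hypothesis chi0 : forall x, chi 0 x = 0.
Hypothesis chi1 : forall g, g != 0 -> chi g g = 1.
Implicit Types (a b c u : hahn G R) (g : G).
Local Notation v := (@hval G R).

(** The derivation varies with the exponent [g], so no single product bounds the support. But no
    derivation enlarges the support of [a], so [supp a + supp a^-1] works for all [g] at once. *)
Lemma hdlog_subproof a :
  well_ordered [set g | (hderiv (chi g) a * a^-1) g != 0].
Proof.
apply: (well_ordered_sub _
  (well_ordered_sumset (@hcoefP _ _ a) (@hcoefP _ _ a^-1))) => g.
move=> /(@hmul_supp _ _ (hderiv (chi g) a) a^-1) [x Dx [y ay xy]]; exists x; last by exists y.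
by move: Dx; rewrite /hsupp /= mulf_eq0 negb_or => /andP[].
Qed.
Definition hdlog a := Hahn (@hdlog_subproof a).

(** At each fixed exponent a single derivation is involved, and the Leibniz rule divided by [a * b]
    gives the sum. *)
Lemma hdlogM a b : a != 0 -> b != 0 -> hdlog (a * b) = hdlog a + hdlog b.
Proof.
move=> a0 b0; apply: hahnP => g.
rewrite -[RHS]/((hderiv (chi g) a * a^-1 + hderiv (chi g) b * b^-1) g).
rewrite -[LHS]/((hderiv (chi g) (a * b) * (a * b)^-1) g); congr (hcoef _ g).
rewrite hderivM // invfM mulrDl; congr (_ + _).
  by rewrite mulrACA (divff b0) mulr1.
by rewrite mulrACA (divff a0) mul1r.
Qed.

(** A derivation does not lower the value, so the quotient by [a] has no negative exponents; at
    exponent 0 the derivation used is zero by [chi0]. *)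
Lemma hdlog_low a g : a != 0 -> g <= 0 -> hdlog a g = 0.
Proof.
move=> a0; rewrite le_eqVlt => /orP[/eqP ->|g0].
  suff D0 : hderiv (chi 0) a = 0.
    by rewrite -[LHS]/((hderiv (chi 0) a * a^-1) 0) D0 mul0r.
  by apply: hahnP => x; rewrite /= chi0 mul0r.
have [||low _] := @hmul_coef_low _ _ (hderiv (chi g) a) a^-1 (v a) (- v a).
- by move=> x xv /=; rewrite (hval_lt a0) ?mulr0.
- by move=> x xv; apply: hval_lt; rewrite ?invr_eq0 // hvalV.
- by rewrite -[LHS]/((hderiv (chi g) a * a^-1) g) low ?subrr.
Qed.

(** A derivation kills the constant 1, so that of [u] starts where [u - 1] does, scaled by
    [chi g gamma]. Division by [u], whose leading term is 1, keeps this term, and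
    [chi gamma gamma = 1]. *)
Lemma hdlog_lead u (gamma := v (u - 1)) : v u = 0 -> u 0 = 1 -> u != 1 ->
  [/\ 0 < gamma, forall g, g < gamma -> hdlog u g = 0
    & hdlog u gamma = (u - 1) gamma].
Proof.
move=> vu u1 un1; have e0 : u - 1 != 0 by rewrite subr_eq0.
have u0 : u != 0 by apply: (@hneq0 _ _ _ 0); rewrite u1 oner_eq0.
have eE g : (u - 1) g = u g - (g == 0)%:R by rewrite hsub_coef hcoef1.
have gamma0 : 0 < gamma.
  have [] // : val_ideal v (u - 1); last by move/eqP; rewrite (negbTE e0).
  apply/hval_idealE => g; rewrite eE le_eqVlt => /orP[/eqP ->|g0].
    by rewrite eqxx u1 subrr.
  by rewrite (hval_lt u0) ?vu // lt_eqF // subrr.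
have low g : (forall q, q < gamma -> hderiv (chi g) u q = 0) /\
             hderiv (chi g) u gamma = chi g gamma * (u - 1) gamma.
  split=> [q qg|]; last by rewrite eE gt_eqF // subr0.
  have := hval_lt e0 qg; rewrite eE; have [->|q0] := eqVneq q 0.
    suff c0 : chi g 0 = 0 by rewrite /= c0 mul0r.
    by apply: (addrI (chi g 0)); rewrite -chiD !addr0.
  by rewrite subr0 /= => ->; rewrite mulr0.
have uV g : g < 0 -> u^-1 g = 0.
  by move=> g0; apply: hval_lt; rewrite ?invr_eq0 // hvalV // vu oppr0.
split => // [g gg|].
  have [l _] := hmul_coef_low (low g).1 uV.
  by rewrite -[LHS]/((hderiv (chi g) u * u^-1) g) l // addr0.
have [_] := hmul_coef_low (low gamma).1 uV; rewrite addr0.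
rewrite -[hdlog u gamma]/((hderiv (chi gamma) u * u^-1) gamma) => ->.
rewrite (low _).2 chi1 ?gt_eqF // mul1r.
by have := hcoefV_lead u0; rewrite vu oppr0 u1 invr1 => ->; rewrite mulr1.
Qed.

Variable h : G -> hahn G R.
Hypothesis hcs : strong_log_cross_section h.

Let hD : {morph h : x y / x + y}. Proof. by case: hcs. Qed.

Lemma cross0 : h 0 = 0.
Proof. by apply: (addrI (h 0)); rewrite -hD !addr0. Qed.

Lemma crossN g : h (- g) = - h g.
Proof. by apply/eqP; rewrite -addr_eq0 -hD addNr cross0. Qed.

Lemma cross_neq0 g : g != 0 -> h g != 0.
Proof.
case: hcs => _ hmono _ _ /oag_neq0 [] /hmono; rewrite cross0 => hg.
  by rewrite lt_eqF.
by rewrite gt_eqF.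
Qed.

Lemma cross_val_lt0 g : g != 0 -> v (h g) < 0.
Proof.
move=> g0; rewrite oag_ltNge; apply/negP => vh.
have : (range h `&` val_ring v) (h g) by split; [exists g|right].
by case: hcs => _ _ -> _ /eqP; rewrite (negbTE (cross_neq0 g0)).
Qed.

Definition hlog a := h (- v a) + hmonom (ln (a (v a))) 0 + hdlog a.

Lemma hlog_lt0E a g : a != 0 -> g < 0 -> hlog a g = h (- v a) g.
Proof.
move=> a0 g0; rewrite -[LHS]/(h (- v a) g + hmonom (ln (a (v a))) 0 g + hdlog a g).
by rewrite hdlog_low ?(ltW g0) //= lt_eqF // !addr0.
Qed.

Lemma hlog_unitE a g : v a = 0 -> hlog a g = hmonom (ln (a 0)) 0 g + hdlog a g.
Proof. by move=> va; rewrite /hlog va oppr0 cross0 add0r. Qed.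

(** The cross-section term starts at a negative exponent, while the other two summands of [hlog a]
    vanish at all negative exponents. *)
Lemma hlog_val a : a != 0 -> v a != 0 ->
  [/\ hlog a != 0, v (hlog a) = v (h (- v a)), v (hlog a) < 0
    & hlog a (v (hlog a)) = h (- v a) (v (h (- v a)))].
Proof.
move=> a0 va0; have nva0 : - v a != 0 by rewrite oppr_eq0.
have v0 := cross_val_lt0 nva0; have h0 := cross_neq0 nva0.
have [hv _] := hvalP h0.
have l : hlog a (v (h (- v a))) = h (- v a) (v (h (- v a))) by rewrite hlog_lt0E.
have e : v (hlog a) = v (h (- v a)).
  apply: hval_eq => [|q qv]; first by rewrite l.
  by rewrite hlog_lt0E ?(hval_lt h0) // (lt_trans qv).
by rewrite e; split => //; apply: (@hneq0 _ _ _ (v (h (- v a)))); rewrite l.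
Qed.

Lemma hlogM a b : 0 < a -> 0 < b -> hlog (a * b) = hlog a + hlog b.
Proof.
move=> /hgt0E [a0 ap] /hgt0E [b0 bp].
rewrite /hlog hdlogM // hvalM // hmul_lead // opprD hD lnM //.
have -> x y : hmonom (x + y) 0 = hmonom x 0 + hmonom y 0 :> hahn G R.
  by apply: hahnP => g /=; case: eqP; rewrite ?addr0.
by rewrite [RHS]addrACA; congr (_ + _); exact: addrACA.
Qed.

(** The leading term of [hlog c] comes from the cross-section if [v c != 0], from [ln] if [c] is a
    unit with constant term other than 1, and from [hdlog] if [c] is a 1-unit. *)
Lemma hlog_gt0 c : 1 < c -> 0 < hlog c.
Proof.
move=> c1; have /hgt0E [c0 cp] : 0 < c := lt_trans ltr01 c1.
have /hgt0E [d0 dp] : 0 < c - 1 by rewrite subr_gt0.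
have [vc|vc] := eqVneq (v c) 0; last first.
  have [l0 e vl le] := hlog_val c0 vc; apply/hgt0E; split=> //; rewrite le.
  have /hgt0E [] // : 0 < h (- v c).
  case: hcs => _ hmono _ _; rewrite -cross0; apply: hmono.
  rewrite oag_oppr_gt0; have [//|vp] := oag_neq0 vc.
  (* A positive value of [c] would give [c - 1] the leading coefficient -1, against [1 < c]. *)
  have c00 g : g <= 0 -> c g = 0 by move=> g0; rewrite (hval_lt c0) // (le_lt_trans g0).
  have vd : v (c - 1) = 0.
    apply: hval_eq => [|q q0]; rewrite hsub_coef hcoef1 c00 ?(ltW q0) //.
      by rewrite eqxx sub0r oppr_eq0 oner_eq0.
    by rewrite lt_eqF // subrr.
  by move: dp; rewrite vd hsub_coef hcoef1 c00 // eqxx sub0r ltr0N1.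
rewrite vc in cp.
have low g : g < 0 -> hlog c g = 0.
  by move=> g0; rewrite hlog_lt0E // vc oppr0 cross0.
have [c01|c01] := eqVneq (c 0) 1; last first.
  have vd : v (c - 1) = 0.
    apply: hval_eq => [|q q0]; rewrite hsub_coef hcoef1 ?eqxx ?subr_eq0 //.
    by rewrite lt_eqF // (hval_lt c0) ?vc // subrr.
  move: dp; rewrite vd hsub_coef hcoef1 eqxx subr_gt0 => c0gt1.
  have l0 : 0 < hlog c 0 by rewrite hlog_unitE // hdlog_low //= eqxx addr0 ln_gt0.
  have vl : v (hlog c) = 0 by apply: hval_eq => //; rewrite gt_eqF.
  by apply/hgt0E; rewrite vl; split => //; apply: (@hneq0 _ _ _ 0); rewrite gt_eqF.
have [g0 lowd le] := hdlog_lead vc c01 (negbT (gt_eqF c1)).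
have lE g : hlog c g = hdlog c g.
  by rewrite hlog_unitE // c01 ln1 /=; case: eqP; rewrite add0r.
have lv : hlog c (v (c - 1)) != 0 by rewrite lE le gt_eqF.
have vl : v (hlog c) = v (c - 1).
  by apply: hval_eq => // q qv; rewrite lE lowd.
by apply/hgt0E; rewrite vl lE le; split => //; exact: hneq0 lv.
Qed.

Lemma hlog_mono a b : 0 < a -> 0 < b -> a < b -> hlog a < hlog b.
Proof.
move=> a0 b0 ab; have ba1 : 1 < b / a by rewrite ltr_pdivlMr // mul1r.
have -> : hlog b = hlog (b / a * a) by rewrite divfK ?lt0r_neq0.
by rewrite hlogM ?divr_gt0 // ltrDr hlog_gt0.
Qed.

Lemma hlog_inj a b : 0 < a -> 0 < b -> hlog a = hlog b -> a = b.
Proof.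
move=> a0 b0 e; have [ab|ba|//] := ltgtP a b.
  by have := hlog_mono a0 b0 ab; rewrite e ltxx.
by have := hlog_mono b0 a0 ba; rewrite e ltxx.
Qed.

Lemma hlog_ring a : 0 < a -> val_ring v (hlog a) -> v a = 0.
Proof.
move=> /hgt0E [a0 _] la; apply/eqP; apply: contrapT => /negP va.
have [l0 _ vl _] := hlog_val a0 va.
case: la => [/eqP|]; first by rewrite (negbTE l0).
by rewrite oag_leNgt vl.
Qed.

Lemma hlog_low a g : a != 0 -> v a = 0 -> g < 0 -> hlog a g = 0.
Proof. by move=> a0 va g0; rewrite hlog_lt0E // va oppr0 cross0. Qed.

Lemma hlog_units : log_units_compatible hlog v.
Proof.
rewrite /log_units_compatible; apply/seteqP; split=> [_ [a [a0 va] <-]|].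
  split; last by exists a.
  by apply/hval_ringE => g; apply: hlog_low; rewrite ?lt0r_neq0.
by move=> x [la [a a0 e]]; exists a => //; split=> //; apply: hlog_ring; rewrite ?e.
Qed.

Lemma hval_add1 a : val_ideal v a -> v (1 + a) = 0 /\ (1 + a) 0 = 1.
Proof.
move=> /hval_idealE a0; have e : (1 + a) 0 = 1.
  by rewrite -[LHS]/((1 : hahn G R) 0 + a 0) a0 // addr0 hcoef1 eqxx.
split=> //; apply: hval_eq => [|q q0]; first by rewrite e oner_eq0.
by rewrite -[LHS]/((1 : hahn G R) q + a q) a0 ?(ltW q0) // hcoef1 lt_eqF ?addr0.
Qed.

(** The constant term of the logarithm of a unit [a] is [ln (a 0)], as [hdlog] has none; it vanishes
    exactly when [a 0 = 1]. *)
Lemma hlog_ideal :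
  hlog @` [set 1 + a | a in val_ideal v] = val_ideal v `&` log_image hlog.
Proof.
apply/seteqP; split=> [_ [_ [a Ia <-] <-]|x [Il [a a0 e]]].
  have [va a1] := hval_add1 Ia.
  have p0 : 0 < 1 + a.
    apply/hgt0E; rewrite va a1; split=> //.
    by apply: (@hneq0 _ _ _ 0); rewrite a1 oner_eq0.
  split; last by exists (1 + a).
  apply/hval_idealE => g; rewrite le_eqVlt => /orP[/eqP ->|g0].
    by rewrite hlog_unitE // hdlog_low ?lt0r_neq0 // a1 ln1 /= eqxx addr0.
  by apply: hlog_low => //; rewrite lt0r_neq0.
have va : v a = 0.
  apply: hlog_ring => //; rewrite e; case: Il => [->|/ltW]; by [left|right].
have [an0 ap] := (hgt0E a).1 a0; rewrite va in ap.
have a1 : a 0 = 1.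
  have := (hval_idealE _).1 Il 0 (lexx _).
  rewrite -e hlog_unitE // hdlog_low // addr0 /= eqxx => /eqP.
  by rewrite ln_eq0 // => /eqP.
exists a => //; exists (a - 1); last by rewrite addrC subrK.
apply/hval_idealE => g; rewrite hsub_coef hcoef1 le_eqVlt => /orP[/eqP ->|g0].
  by rewrite eqxx a1 subrr.
by rewrite lt_eqF // (hval_lt an0) ?va // subrr.
Qed.

Lemma hmonomD p q : hmonom 1 p * hmonom 1 q = hmonom 1 (p + q) :> hahn G R.
Proof.
apply: hahnP => g; rewrite [LHS]hmonomM mul1r /=.
by rewrite -[g == _](inj_eq (addIr (- p))) [p + q]addrC addrK.
Qed.

Lemma hmonom_gt0 g : 0 < hmonom 1 g :> hahn G R.
Proof.
apply/hgt0E; rewrite hval_monom ?oner_eq0 //= eqxx ltr01; split=> //.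
by apply: hmonom_neq0; rewrite oner_eq0.
Qed.

Lemma hmonom_complement :
  pos_complement (range (hmonom 1)) (@pos_units (hahn G R) G v).
Proof.
have mV g : (hmonom 1 g)^-1 = hmonom 1 (- g) :> hahn G R.
  apply: (mulfI (lt0r_neq0 (hmonom_gt0 g))).
  by rewrite divff ?hmonomD ?subrr // lt0r_neq0 ?hmonom_gt0.
split.
- split; first by move=> _ [g _ <-]; exact: hmonom_gt0.
  + by exists 0.
  + move=> a b /set_mem [p _ <-] /set_mem [q _ <-].
    by exists (p + q); rewrite ?hmonomD.
  + by move=> a /set_mem [p _ <-]; exists (- p); rewrite ?mV.
- apply/seteqP; split=> [_ [[g _ <-] [_]]|_ ->].
    by rewrite hval_monom ?oner_eq0 // => ->.
  by split; [exists 0|split; [exact: ltr01|exact: hval1]].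
- move=> a a0; exists (hmonom 1 (v a)); first by exists (v a).
  exists ((hmonom 1 (v a))^-1 * a); last by rewrite mulVKf ?lt0r_neq0 ?hmonom_gt0.
  split; first by rewrite mulr_gt0 // invr_gt0 hmonom_gt0.
  rewrite mV hvalM ?hval_monom ?oner_eq0 ?addNr //; last exact: lt0r_neq0.
  by rewrite lt0r_neq0 ?hmonom_gt0.
Qed.

Lemma hlog_gives_rise : gives_rise_to h hlog.
Proof.
split.
- by split; [exact: hlogM|exact: hlog_mono].
- by split; [exact: hlog_units|exact: hlog_ideal].
exists (range (hmonom 1)); first exact: hmonom_complement.
move=> _ /set_mem [g _ <-]; apply: hahnP => q.
have m0 : hmonom 1 g != 0 :> hahn G R by rewrite lt0r_neq0 ?hmonom_gt0.
have D0 : hdlog (hmonom 1 g) q = 0.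
  have [q0|q0] := oag_ltP 0 q; last exact: hdlog_low.
  have low x : x < g -> hderiv (chi q) (hmonom 1 g) x = 0.
    by move=> xg; rewrite /= lt_eqF // mulr0.
  rewrite -[LHS]/((hderiv (chi q) (hmonom 1 g) * (hmonom 1 g)^-1) q).
  (* A monomial is an eigenvector of every derivation, so its logarithmic derivative is a constant,
     with no coefficient at [q > 0]. *)
  have -> : hderiv (chi q) (hmonom 1 g) = hmonom (chi q g) 0 * hmonom 1 g.
    apply: hahnP => x; rewrite [RHS]hmonomM subr0 /=.
    by case: eqP => [->|_]; rewrite ?mulr1 ?mulr0.
  by rewrite mulfK //= gt_eqF.
rewrite -[LHS]/(h (- v (hmonom 1 g)) q + _ + hdlog (hmonom 1 g) q) D0 addr0.
rewrite hval_monom ?oner_eq0 //= eqxx ln1.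
by case: eqP; rewrite addr0.
Qed.

Lemma hlog_strong : strong_log hlog.
Proof.
move=> a /[dup] a0 /hgt0E [an0 _] nr; have va : v a < 0.
  by rewrite oag_ltNge; apply/negP => va; apply: nr; right.
have [_ -> _ _] := hlog_val an0 (negbT (lt_eqF va)).
(* Since [v (hlog a) = v (h (- v a)) = v (h (v a))], the strength of the cross-section at [v a < 0]
   is what is asked. *)
rewrite crossN hvalN; case: hcs => _ _ _; exact.
Qed.

End Logarithm.

(** * Lexicographic sums and their archimedean classes *)

(** Totality is a hypothesis so that this applies both to the index set and to an [oagType], which
    is only a partial order structurally. *)
Lemma finite_least d (T : porderType d) (A : set T) :
  total (<=%O : rel T) -> finite_set A -> A !=set0 ->
  exists2 m, A m & forall x, A x -> (m <= x)%O.
Proof.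
move=> tot /finite_seqP [s ->]; elim: s => [[]//|x s IH _].
have [s0|s0] := pselect ([set` s] !=set0); last first.
  exists x; rewrite /= ?mem_head // => y /=; rewrite inE => /orP[/eqP -> //|ys].
  by case: s0; exists y.
have [m ms mmin] := IH s0; have /orP[xm|mx] := tot x m.
  exists x; rewrite /= ?mem_head // => y /=; rewrite inE => /orP[/eqP -> //|ys].
  by apply: le_trans xm _; exact: mmin.
exists m; rewrite /= ?inE; first by apply/orP; right.
by move=> y /=; rewrite inE => /orP[/eqP -> //|]; exact: mmin.
Qed.

Section LexSum.
Variables (d : Order.disp_t) (I : orderType d) (R : realType).

(* Ordered lexicographically, smaller indices dominating. *)
Record lexsum := LexSum {
  lscoef :> I -> R;
  lscoefP : finite_set [set i | lscoef i != 0] }.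

HB.instance Definition _ := gen_eqMixin lexsum.
HB.instance Definition _ := gen_choiceMixin lexsum.
Implicit Types (f g : lexsum) (i j : I).

Lemma lexsumP f g : f =1 g -> f = g.
Proof.
case: f g => f wf [g wg] /= /funext fg; rewrite fg in wf *.
by congr LexSum; apply: Prop_irrelevance.
Qed.

Lemma lszero_subproof : finite_set [set i : I | (0 : R) != 0].
Proof. by apply: sub_finite_set (@finite_set0 I) => i /=; rewrite eqxx. Qed.
Definition lszero := LexSum lszero_subproof.

Lemma lsadd_subproof f g : finite_set [set i | f i + g i != 0].
Proof.
have fU : finite_set ([set i | f i != 0] `|` [set i | g i != 0]).
  by rewrite finite_setU; split; exact: lscoefP.
apply: sub_finite_set fU => i /=; have [->|f0 _] := eqVneq (f i) 0; last by left.
by rewrite add0r; right.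
Qed.
Definition lsadd f g := LexSum (@lsadd_subproof f g).

Lemma lsscale_subproof (c : R) f : finite_set [set i | c * f i != 0].
Proof.
apply: sub_finite_set (@lscoefP f) => i /=.
by rewrite mulf_eq0 negb_or => /andP[].
Qed.
Definition lsscale c f := LexSum (@lsscale_subproof c f).

Fact lsaddA : associative lsadd.
Proof. by move=> a b c; apply: lexsumP => g /=; rewrite addrA. Qed.
Fact lsaddC : commutative lsadd.
Proof. by move=> a b; apply: lexsumP => g /=; rewrite addrC. Qed.
Fact lsadd0 : left_id lszero lsadd.
Proof. by move=> a; apply: lexsumP => g /=; rewrite add0r. Qed.
Fact lsaddN : left_inverse lszero (lsscale (-1)) lsadd.
Proof. by move=> a; apply: lexsumP => g /=; rewrite mulN1r addNr. Qed.

HB.instance Definition _ :=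
  GRing.isZmodule.Build lexsum lsaddA lsaddC lsadd0 lsaddN.

Lemma lsoppE f i : (- f) i = - f i.
Proof. exact: mulN1r. Qed.

Lemma lssubE f g i : (f - g) i = f i - g i.
Proof. by rewrite -[LHS]/(f i + (- g) i) lsoppE. Qed.

Lemma lsmulrnE f n i : (f *+ n) i = f i *+ n.
Proof. by elim: n => // n IHn; rewrite !mulrS -IHn. Qed.

Definition is_lead f i := f i != 0 /\ forall j, (j < i)%O -> f j = 0.

Lemma lead_ex f : f != 0 -> exists i, is_lead f i.
Proof.
move=> f0; have [|i fi imin] := finite_least (@le_total _ I) (@lscoefP f).
  apply: contrapT => /forallNP fn; move/eqP: f0; apply; apply: lexsumP => i.
  by apply: contrapT => /eqP fi; apply: (fn i).
exists i; split=> // j ji; apply: contrapT => /eqP /imin.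
by rewrite leNgt ji.
Qed.

Lemma lead_uniq f i j : is_lead f i -> is_lead f j -> i = j.
Proof.
move=> [fi li] [fj lj]; have [/lj /eqP|/li /eqP|//] := ltgtP i j.
  by rewrite (negbTE fi).
by rewrite (negbTE fj).
Qed.

Lemma lead_neq0 f i : is_lead f i -> f != 0.
Proof. by move=> [fi _]; apply/eqP => f0; move: fi; rewrite f0 eqxx. Qed.

Lemma leadN f i : is_lead f i -> is_lead (- f) i.
Proof.
move=> [fi li]; rewrite /is_lead lsoppE oppr_eq0; split=> // j /li fj.
by rewrite lsoppE fj oppr0.
Qed.

Definition lspos f := exists2 i, 0 < f i & forall j, (j < i)%O -> f j = 0.
Definition lslt f g := `[< lspos (g - f) >].
Definition lsle f g := (f == g) || lslt f g.

Lemma lspos_lead f i : is_lead f i -> lspos f <-> 0 < f i.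
Proof.
move=> [fi li]; split=> [[j fj lj]|fi0]; last by exists i.
by rewrite (@lead_uniq f i j) //; split=> //; rewrite gt_eqF.
Qed.

Lemma lsposD f g : lspos f -> lspos g -> lspos (f + g).
Proof.
move=> [i fi li] [j gj lj]; have [ij|ji|ij] := ltgtP i j.
- exists i => [|k ki]; first by rewrite /= lj // addr0.
  by rewrite /= li // lj ?addr0 // (lt_trans ki).
- exists j => [|k kj]; first by rewrite /= li // add0r.
  by rewrite /= lj // li ?addr0 // (lt_trans kj).
- exists i => [|k ki]; first by rewrite /= addr_gt0 // ij.
  by rewrite /= li // lj ?addr0 // -ij.
Qed.

Lemma lspos0 : ~ lspos 0.
Proof. by case=> i; rewrite /= ltxx. Qed.

Fact lslt_def f g : lslt f g = (g != f) && lsle f g.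
Proof.
rewrite /lsle [f == g]eq_sym; have [->|//] := eqVneq g f.
by apply/asboolP; rewrite subrr; exact: lspos0.
Qed.
Fact lsle_refl : reflexive lsle.
Proof. by move=> f; rewrite /lsle eqxx. Qed.
Fact lsle_anti : antisymmetric lsle.
Proof.
move=> f g /andP[/orP[/eqP //|/asboolP fg] /orP[/eqP //|/asboolP gf]].
by have := lsposD fg gf; rewrite addrC subrKA subrr => /lspos0.
Qed.
Fact lsle_trans : transitive lsle.
Proof.
move=> g f k /orP[/eqP -> //|/asboolP fg] /orP[/eqP <-|/asboolP gk].
  by apply/orP; right; apply/asboolP.
apply/orP; right; apply/asboolP.
by have := lsposD gk fg; rewrite subrKA.
Qed.

HB.instance Definition _ :=
  Order.isPOrder.Build ring_display lexsum lslt_def lsle_refl lsle_anti lsle_trans.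

Fact lsle_total : total (<=%R : rel lexsum).
Proof.
move=> f g; have [->|fg] := eqVneq f g; first by rewrite lexx.
have [i li] : exists i, is_lead (g - f) i by apply: lead_ex; rewrite subr_eq0 eq_sym.
have [c0|c0|c0] := ltrgtP 0 ((g - f) i).
- apply/orP; left; apply/orP; right; apply/asboolP.
  by apply/(lspos_lead li).
- apply/orP; right; apply/orP; right; apply/asboolP.
  by rewrite -opprB; apply/(lspos_lead (leadN li)); rewrite lsoppE oppr_gt0.
- by case: li; rewrite -c0 eqxx.
Qed.

Fact lsle_add f g k : f <= g -> f + k <= g + k.
Proof.
move=> /orP[/eqP ->|/asboolP fg]; first exact: lexx.
by apply/orP; right; apply/asboolP; rewrite opprD addrACA subrr addr0.
Qed.

HB.instance Definition _ :=
  isOrderedAbelianGroup.Build lexsum lsle_total lsle_add.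

Lemma lsgt0_lead f i : is_lead f i -> (0 < f) = (0 < f i).
Proof.
move=> li; apply/idP/idP => [/asboolP|f0].
  by rewrite subr0 => /(lspos_lead li).
by apply/asboolP; rewrite subr0; apply/(lspos_lead li).
Qed.

Lemma lslt0_lead f i : is_lead f i -> (f < 0) = (f i < 0).
Proof. by move=> li; rewrite -oag_oppr_gt0 (lsgt0_lead (leadN li)) lsoppE oppr_gt0. Qed.

Lemma lexsum_divisible : divisible_group lexsum.
Proof.
move=> n f n0; exists (lsscale n%:R^-1 f); apply: lexsumP => i.
by rewrite lsmulrnE /= -[LHS]mulr_natl mulVKf // pnatr_eq0 -lt0n.
Qed.

Lemma lead_abs f i : is_lead f i -> is_lead (oag_abs f) i /\ 0 < oag_abs f i.
Proof.
move=> li; have lN := leadN li; have [f0|] := oag_ltP 0 f.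
  have -> : oag_abs f = f.
    by rewrite /oag_abs /Order.max ifN // -oag_leNgt ltW // (lt_trans _ f0) // oag_oppr_lt0.
  by rewrite -(lsgt0_lead li).
rewrite le_eqVlt (negbTE (lead_neq0 li)) /= => f0.
have nf0 : 0 < - f by rewrite oag_oppr_gt0.
have -> : oag_abs f = - f by rewrite /oag_abs /Order.max (lt_trans f0 nf0).
by rewrite -(lsgt0_lead lN).
Qed.

(** If [i < j], all multiples of [y] vanish up to and including [i], where [x] does not. If
    [j <= i], comparing the coefficients at [j] shows that some multiple of [|y|] exceeds [|x|]. *)
Lemma arch_lt_lead (x y : nonzero lexsum) i j :
  is_lead (val x) i -> is_lead (val y) j -> arch_lt x y <-> (i < j)%O.
Proof.
move=> /lead_abs [[xi lx] x0] /lead_abs [[yj ly] y0].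
split=> [xy|ij n]; last first.
  rewrite -oag_subr_gt0 (@lsgt0_lead _ i).
    by rewrite lssubE lsmulrnE ly // mul0rn subr0.
  split=> [|k ki]; first by rewrite lssubE lsmulrnE ly // mul0rn subr0.
  by rewrite lssubE lsmulrnE lx // ly ?mul0rn ?subr0 // (lt_trans ki).
rewrite ltNge; apply/negP => ji.
(* The archimedean property of [R] gives [n]; for [j < i] the coefficient of [x] here is 0. *)
have [n yn] : exists n, oag_abs (val x) j < oag_abs (val y) j *+ n.
  exists (Num.bound (`|oag_abs (val x) j| / oag_abs (val y) j)).
  apply: le_lt_trans (ler_norm _) _; rewrite -mulr_natl -ltr_pdivrMr //.
  by apply: archi_boundP; rewrite divr_ge0 // ltW.
have := xy n; rewrite -oag_subr_gt0 (@lsgt0_lead _ j).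
  by rewrite lssubE lsmulrnE subr_gt0 ltNge (ltW yn).
split=> [|k kj]; first by rewrite lssubE lsmulrnE lt_eqF // subr_lt0.
by rewrite lssubE lsmulrnE ly // lx ?mul0rn ?subr0 // (lt_le_trans kj).
Qed.

Lemma lsdelta_subproof i :
  finite_set [set j | (if j == i then 1 else 0 : R) != 0].
Proof.
apply: sub_finite_set (finite_set1 i) => j /=.
by case: (j =P i) => //= _; rewrite eqxx.
Qed.
Definition lsdelta i := LexSum (@lsdelta_subproof i).

Lemma lsdelta_diag i : lsdelta i i = 1.
Proof. by rewrite /= eqxx. Qed.

Lemma lsdelta_low i j : (j < i)%O -> lsdelta i j = 0.
Proof. by move=> /lt_eqF /= ->. Qed.

Lemma lead_delta i : is_lead (lsdelta i) i.
Proof. by split=> [|j]; [rewrite lsdelta_diag oner_eq0|exact: lsdelta_low]. Qed.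

Lemma lsdelta_inj : injective lsdelta.
Proof.
by move=> i j e; apply: (lead_uniq (lead_delta i)); rewrite e; exact: lead_delta.
Qed.

Definition lsdelta_nonzero i : nonzero lexsum :=
  exist _ (lsdelta i) (lead_neq0 (lead_delta i)).

Definition ls_class i : archClass lexsum :=
  \pi_(archClass lexsum) (lsdelta_nonzero i).

Lemma pi_lead (x : nonzero lexsum) i :
  is_lead (val x) i -> \pi_(archClass lexsum) x = ls_class i.
Proof.
move=> li; have ld := lead_delta i.
have [||//] := ltgtP (\pi_(archClass lexsum) x) (ls_class i).
  by move/pi_arch_lt/(@arch_lt_lead x (lsdelta_nonzero i) i i li ld); rewrite ltxx.
by move/pi_arch_lt/(@arch_lt_lead (lsdelta_nonzero i) x i i ld li); rewrite ltxx.
Qed.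

Lemma natval_lead f i : is_lead f i -> natval f = Some (ls_class i).
Proof.
move=> li; rewrite /natval (insubT (fun x => x != 0) (lead_neq0 li)) /=; congr Some.
exact: pi_lead.
Qed.

Lemma ls_class_lt i j : (ls_class i < ls_class j)%O = (i < j)%O.
Proof.
have := @arch_lt_lead (lsdelta_nonzero i) (lsdelta_nonzero j) i j
  (lead_delta i) (lead_delta j).
by move=> ij; apply/idP/idP => [/pi_arch_lt/ij //|/ij]; move/pi_arch_lt.
Qed.

Lemma ls_class_le i j : (ls_class i <= ls_class j)%O = (i <= j)%O.
Proof. by rewrite !leNgt ls_class_lt. Qed.

Lemma ls_class_inj : injective ls_class.
Proof. by move=> i j e; apply/le_anti; rewrite -!ls_class_le e lexx. Qed.

(** With [ls_class_le], this identifies the ordered set of archimedean classes with [I]. *)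
Lemma ls_class_surj (A : archClass lexsum) : exists i, ls_class i = A.
Proof.
have [i li] := lead_ex (valP (repr A)); exists i.
by rewrite -(pi_lead li) reprK.
Qed.

Definition ls_index (A : archClass lexsum) : I := sval (cid (ls_class_surj A)).

Lemma ls_indexK : cancel ls_index ls_class.
Proof. by move=> A; rewrite /ls_index; case: cid. Qed.

Lemma ls_classK : cancel ls_class ls_index.
Proof. by move=> i; apply: ls_class_inj; rewrite ls_indexK. Qed.

Lemma lead_natval f i : natval f = Some (ls_class i) -> is_lead f i.
Proof.
have [->|f0] := eqVneq f 0; first by rewrite /natval insubF // eqxx.
by have [j lj] := lead_ex f0; rewrite (natval_lead lj) => -[/ls_class_inj <-].
Qed.

End LexSum.

(** * The cross-section of a lexicographic sum *)

Section CrossSection.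
Variables (d : Order.disp_t) (I : orderType d) (R : realType) (zeta : I -> I).
Hypothesis zeta_mono : {homo zeta : i j / (i < j)%O}.
Hypothesis zeta_gt : forall i, (i < zeta i)%O.
Local Notation G := (lexsum I R).
Local Notation K := (hahn G R).
Local Notation v := (@hval G R).
Implicit Types (f g x : G) (i j : I).

Lemma lsdelta_lt i j : (i < j)%O -> lsdelta R j < lsdelta R i.
Proof.
move=> ij; rewrite -oag_subr_gt0 (@lsgt0_lead _ _ _ _ i).
  by rewrite lssubE lsdelta_diag lsdelta_low // subr0.
split=> [|k ki]; first by rewrite lssubE lsdelta_diag lsdelta_low // subr0 oner_eq0.
by rewrite lssubE !lsdelta_low ?subr0 // (lt_trans ki).
Qed.

Lemma zeta_inj : injective zeta.
Proof.
move=> i j e; have [/zeta_mono|/zeta_mono|//] := ltgtP i j.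
  by rewrite e ltxx.
by rewrite e ltxx.
Qed.

(** The index is taken by choice; it is unique because [zeta] and [lsdelta] are injective. *)
Definition ls_cross_coef f x : R :=
  if pselect (exists i, x = - lsdelta R (zeta i)) is left e
  then f (sval (cid e)) else 0.

Lemma ls_cross_coefE f i : ls_cross_coef f (- lsdelta R (zeta i)) = f i.
Proof.
rewrite /ls_cross_coef; case: pselect => [e|[]]; last by exists i.
by case: cid => j /= /oppr_inj /lsdelta_inj /zeta_inj ->.
Qed.

Lemma ls_cross_coef_supp f x : ls_cross_coef f x != 0 ->
  exists2 i, f i != 0 & x = - lsdelta R (zeta i).
Proof.
rewrite /ls_cross_coef; case: pselect => [e|]; last by rewrite eqxx.
by case: cid => i /= xi fi; exists i.
Qed.

Lemma ls_cross_subproof f : well_ordered [set x | ls_cross_coef f x != 0].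
Proof.
move=> B BS B0; apply: finite_least => //; first exact: oag_le_total.
apply: sub_finite_set (finite_image (fun i => - lsdelta R (zeta i)) (@lscoefP _ _ _ f)).
by move=> x /BS /ls_cross_coef_supp [i fi ->]; exists i.
Qed.
Definition ls_cross f : K := Hahn (@ls_cross_subproof f).

Lemma ls_crossD : {morph ls_cross : f g / f + g}.
Proof.
move=> f g; apply: hahnP => x.
rewrite -[RHS]/(ls_cross_coef f x + ls_cross_coef g x) /= /ls_cross_coef.
by case: pselect => // _; rewrite addr0.
Qed.

(** The map sending [i] to [- lsdelta R (zeta i)] is strictly increasing, since [lsdelta] and
    negation both reverse the order; so the leading index yields the least exponent. *)
Lemma ls_cross_lead f i : is_lead f i ->
  v (ls_cross f) = - lsdelta R (zeta i) /\
  ls_cross f (- lsdelta R (zeta i)) = f i.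
Proof.
move=> [fi li]; have e := ls_cross_coefE f i; split=> //.
apply: hval_eq => [|x xi]; first by rewrite /= e.
apply: contrapT => /eqP /ls_cross_coef_supp [j fj xj].
have [ji|ij|ij] := ltgtP i j.
- by move: xi; rewrite xj oag_ltNge oag_leN ltW // lsdelta_lt // zeta_mono.
- by move: fj; rewrite li ?eqxx.
- by move: xi; rewrite xj ij ltxx.
Qed.

Lemma ls_cross_gt0 f : 0 < f -> 0 < ls_cross f.
Proof.
move=> f0; have [i li] : exists i, is_lead f i by apply: lead_ex; rewrite gt_eqF.
have [vf fE] := ls_cross_lead li.
have fi : 0 < f i by rewrite -(lsgt0_lead li).
apply/hgt0E; rewrite vf fE; split=> //; apply: (@hneq0 _ _ _ (- lsdelta R (zeta i))).
by rewrite fE gt_eqF.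
Qed.

Lemma lsdelta_gt0 i : 0 < lsdelta R i.
Proof. by rewrite (lsgt0_lead (lead_delta R i)) lsdelta_diag. Qed.

Lemma ls_cross_section : strong_log_cross_section ls_cross.
Proof.
have c0 : ls_cross 0 = 0 by apply: (addrI (ls_cross 0)); rewrite -ls_crossD !addr0.
split; first exact: ls_crossD.
- move=> f g fg; have := ls_cross_gt0 (_ : 0 < g - f); rewrite oag_subr_gt0 => /(_ fg).
  by rewrite -(ltrD2r (ls_cross f)) -ls_crossD subrK add0r.
- apply/seteqP; split=> [_ [[f _ <-] rf]|_ ->]; last first.
    by split; [exists 0|left].
  have [->|/lead_ex [i li]] := eqVneq f 0; first exact: c0.
  have [vf _] := ls_cross_lead li; case: rf => //.
  by rewrite vf oag_leNgt oag_oppr_lt0 lsdelta_gt0.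
- move=> f f0; have [i li] : exists i, is_lead f i by apply: lead_ex; rewrite lt_eqF.
  have [-> _] := ls_cross_lead li.
  (* As [i < zeta i], the delta vanishes at all indices up to [i], so the difference has leading
     index [i] and coefficient [- f i > 0]. *)
  have e : (- lsdelta R (zeta i) - f) i = - f i.
    by rewrite lssubE lsoppE lsdelta_low ?zeta_gt // oppr0 add0r.
  have fi : 0 < - f i by rewrite oppr_gt0 -(lslt0_lead li).
  rewrite -oag_subr_gt0 (@lsgt0_lead _ _ _ _ i) ?e //.
  split=> [|j ji]; first by rewrite e gt_eqF.
  rewrite lssubE lsoppE lsdelta_low ?(lt_trans ji (zeta_gt i)) // oppr0 add0r.
  by rewrite (proj2 li) ?oppr0.
Qed.

(** This provides the additive maps [chi g]: the coordinate at the leading index of [g], normalized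
    to be 1 at [g]. The default 0 occurs only for [g = 0], as [chi0] demands. *)
Definition ls_coord g x : R :=
  if pselect (exists i, is_lead g i) is left e
  then x (sval (cid e)) / g (sval (cid e)) else 0.

Lemma ls_coordD g : {morph ls_coord g : x y / x + y}.
Proof.
move=> x y; rewrite /ls_coord; case: pselect => [e|_]; last by rewrite addr0.
by rewrite -mulrDl.
Qed.

Lemma ls_coord0 x : ls_coord 0 x = 0.
Proof.
rewrite /ls_coord; case: pselect => // e.
by case: cid => i li; have /eqP := lead_neq0 li.
Qed.

Lemma ls_coord1 g : g != 0 -> ls_coord g g = 1.
Proof.
move=> /lead_ex g0; rewrite /ls_coord; case: pselect => // e.
by case: cid => i [gi _] /=; rewrite divff.
Qed.

Definition ls_log : K -> K := hlog ls_coord ls_cross.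

Lemma ls_log_gives_rise : gives_rise_to ls_cross ls_log.
Proof.
exact (hlog_gives_rise ls_coordD ls_coord0 ls_coord1 ls_cross_section).
Qed.

Lemma ls_log_strong : strong_log ls_log.
Proof. exact (hlog_strong ls_coord0 ls_cross_section). Qed.

Lemma ls_log_inj a b : 0 < a -> 0 < b -> ls_log a = ls_log b -> a = b.
Proof. exact (hlog_inj ls_coordD ls_coord0 ls_coord1 ls_cross_section (a := a) (b := b)). Qed.

Lemma ls_log_lead (a : K) i : a != 0 -> is_lead (v a) i ->
  ls_log a != 0 /\ v (ls_log a) = - lsdelta R (zeta i).
Proof.
move=> a0 li; have lN := leadN li.
have [l0 -> _ _] := hlog_val ls_coord0 ls_cross_section a0 (lead_neq0 li).
by have [-> _] := ls_cross_lead lN.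
Qed.

Lemma ls_log_nonsurj : inhabited I -> log_image ls_log <> setT.
Proof.
(* The negative part of a logarithm comes from the cross-section, whose exponents are
   [- lsdelta R (zeta j)]. The negative exponent [g] has leading coefficient -2, so the monomial at
   [g] is no logarithm. *)
move=> [i] imT; pose g : G := - lsdelta R i *+ 2.
have gi : g i = - 1 *+ 2 by rewrite lsmulrnE lsoppE lsdelta_diag.
have lg : is_lead g i.
  split=> [|j ji]; first by rewrite gi mulrn_eq0 oppr_eq0 oner_eq0.
  by rewrite lsmulrnE lsoppE lsdelta_low // oppr0 mul0rn.
have : log_image ls_log (hmonom 1 g) by rewrite imT.
move=> [a /hgt0E [a0 _] /(congr1 (fun b : K => b g))].
rewrite (hlog_lt0E ls_coord0) //; last first.
  by rewrite (lslt0_lead lg) gi mulrn_wlt0 // ltrN10.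
move=> /= e; have : ls_cross_coef (- v a) g != 0 by rewrite e eqxx oner_eq0.
move=> /ls_cross_coef_supp [j _ gj].
have ld : is_lead (- lsdelta R (zeta j)) (zeta j) := leadN (lead_delta R _).
have ij : i = zeta j by apply: (lead_uniq lg); rewrite gj.
have := gi; rewrite gj -ij lsoppE lsdelta_diag mulr2n => /eqP.
by rewrite -subr_eq0 opprD addrA subrr add0r opprK oner_eq0.
Qed.

Definition class_shift (A : archClass G) : archClass G :=
  ls_class R (zeta (ls_index A)).

Lemma ls_index_le (A B : archClass G) : (ls_index A <= ls_index B)%O = (A <= B)%O.
Proof. by rewrite -(ls_class_le R) !ls_indexK. Qed.

Lemma class_shift_mono : {mono class_shift : A B / (A <= B)%O}.
Proof.
move=> A B; rewrite /class_shift ls_class_le -[RHS]ls_index_le.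
exact: le_mono.
Qed.

Lemma class_shift_gt A : (A < class_shift A)%O.
Proof. by rewrite -[A in (A < _)%O]ls_indexK /class_shift ls_class_lt. Qed.

Lemma ls_log_zeta : is_log_zeta ls_log class_shift.
Proof.
split=> [A B AB|a a0 nr]; first by rewrite class_shift_mono.
have [an0 _] := (hgt0E a).1 a0.
have va : v a < 0 by rewrite oag_ltNge; apply/negP => va; apply: nr; right.
have [i li] : exists i, is_lead (v a) i by apply: lead_ex; rewrite lt_eqF.
have [_ ->] := ls_log_lead an0 li.
rewrite (natval_lead li) (natval_lead (leadN (lead_delta R (zeta i)))) /=.
by rewrite /class_shift ls_classK.
Qed.

End CrossSection.

(** * Coarsenings and the principal exponential rank *)

Section Coarsening.
Variables (G H : oagType) (R : realType) (w : hahn G R -> H).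
Local Notation v := (@hval G R).
Hypothesis wc : coarsening w.

(** The map is [W g = w (t^g)]. If [v a <= v b], then [b / a] lies in the ring of [v], hence in that
    of [w], so [w a <= w b]; thus [w] depends on [v] alone and monotonically. *)
Lemma coarsening_factor :
  exists W : G -> H, [/\ {morph W : x y / x + y},
    {homo W : x y / x <= y} & forall a, a != 0 -> w a = W (v a)].
Proof.
have [[wM _] vw] := wc.
have w1 : w 1 = 0.
  by apply: (addrI (w 1)); rewrite -wM ?oner_eq0 // mulr1 addr0.
have wV a : a != 0 -> w a^-1 = - w a.
  by move=> a0; apply/eqP; rewrite -addr_eq0 -wM ?invr_eq0 // mulVf ?w1.
have wle a b : a != 0 -> b != 0 -> v a <= v b -> w a <= w b.
  move=> a0 b0 ab; have ba0 : b / a != 0 by rewrite mulf_neq0 ?invr_eq0.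
  have : val_ring w (b / a).
    by apply: vw; right; rewrite hvalM ?invr_eq0 // hvalV // oag_subr_ge0.
  case=> [/eqP|]; first by rewrite (negbTE ba0).
  by rewrite wM ?invr_eq0 // wV // oag_subr_ge0.
pose m g : hahn G R := hmonom 1 g.
have m0 g : m g != 0 by apply: hmonom_neq0; rewrite oner_eq0.
have vm g : v (m g) = g by rewrite hval_monom ?oner_eq0.
exists (w \o m); split=> [x y|x y xy|a a0] /=.
- by rewrite -wM // hmonomD.
- by apply: wle; rewrite ?vm.
- by apply/le_anti; rewrite !wle ?vm.
Qed.

End Coarsening.

Lemma hval_add (G : oagType) (R : realType) (a b : hahn G R) :
  a + b != 0 -> (hval a <= hval (a + b)) || (hval b <= hval (a + b)).
Proof.
move=> /hvalP [ab _].
have [a0|a0] := eqVneq (a (hval (a + b))) 0; last first.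
  by apply/orP; left; have [|_] := @hvalP _ _ a; [exact: hneq0 a0|apply].
have b0 : b (hval (a + b)) != 0.
  by move: ab; rewrite -[X in X != 0]/(a (hval (a + b)) + b (hval (a + b))) a0 add0r.
by apply/orP; right; have [|_] := @hvalP _ _ b; [exact: hneq0 b0|apply].
Qed.

(** * The index set [T * Z], its shift and the orbit classes *)

Section ShiftedSum.
Variables (d : Order.disp_t) (T : orderType d) (R : realType).
Local Notation I := (T *l int)%type.
Local Notation G := (lexsum I R).
Local Notation K := (hahn G R).
Local Notation v := (@hval G R).
Implicit Types (p q : I) (f g : G) (s t : T).

Lemma lexi_le p q :
  (p <= q)%O = (p.1 <= q.1)%O && ((q.1 <= p.1)%O ==> (p.2 <= q.2)%O).
Proof. by case: p q => p1 p2 [q1 q2]. Qed.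

Lemma lexi_fst p q : (p <= q)%O -> (p.1 <= q.1)%O.
Proof. by rewrite lexi_le => /andP[]. Qed.

Lemma lexi_lt p q : (p.1 < q.1)%O -> (p < q)%O.
Proof. by move=> pq; rewrite ltNge lexi_le negb_and leNgt pq. Qed.

Definition shift (p : I) : I := (p.1, p.2 + 1).

Lemma shift_gt p : (p < shift p)%O.
Proof. by rewrite ltNge lexi_le /= !lexx /= -ltNge ltrDl. Qed.

Lemma shift_mono : {homo shift : p q / (p < q)%O}.
Proof.
by move=> p q; rewrite !ltNge !lexi_le /= lerD2r.
Qed.

Definition unshift (p : I) : I := (p.1, p.2 - 1).

Lemma shiftK : cancel shift unshift.
Proof. by case=> t n; rewrite /unshift /= addrK. Qed.
Lemma unshiftK : cancel unshift shift.
Proof. by case=> t n; rewrite /shift /= subrK. Qed.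

Local Notation z := (class_shift (I := I) (R := R) shift).

Lemma class_shift_auto : order_automorphism z.
Proof.
split; last exact: class_shift_mono shift_mono.
exists (class_shift unshift) => A; rewrite /class_shift ls_classK.
  by rewrite shiftK ls_indexK.
by rewrite unshiftK ls_indexK.
Qed.

Lemma iter_shift n (A : archClass G) :
  iter n z A = ls_class R (((ls_index A).1, (ls_index A).2 + n%:Z) : I).
Proof.
elim: n => [|n IH] /=; first by rewrite addr0 -surjective_pairing ls_indexK.
by rewrite IH /class_shift ls_classK /shift /= -addrA -PoszD addn1.
Qed.

(** The shift fixes first components, so an element between two points of one orbit has the same
    first component. *)
Lemma hull_orbit_fst (A B : archClass G) :
  convex_hull (iter_orbit z A) B -> (ls_index B).1 = (ls_index A).1.
Proof.
move=> [_ [n _ <-] [_ [m _ <-]]]; rewrite !iter_shift -!(ls_index_le (R := R)) !ls_classK.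
by move=> /andP[/lexi_fst h1 /lexi_fst h2]; apply/le_anti/andP.
Qed.

Lemma orbit_classE (A : archClass G) :
  orbit_class z A = [set B : archClass G | (ls_index B).1 = (ls_index A).1].
Proof.
apply/seteqP; split=> [B [C [/hull_orbit_fst CA /hull_orbit_fst CB]]|B /= BA].
  by rewrite /= -CB.
(* Both orbits pass through the point of their common fiber with second component [m]. *)
pose m := Num.max (ls_index A).2 (ls_index B).2.
exists (ls_class R (((ls_index A).1, m) : I)).
have hull (C : archClass G) : (ls_index C).1 = (ls_index A).1 -> (ls_index C).2 <= m ->
    convex_hull (iter_orbit z C) (ls_class R (((ls_index A).1, m) : I)).
  move=> CA Cm; have D : iter_orbit z C (ls_class R (((ls_index A).1, m) : I)).
    exists `|m - (ls_index C).2|%N => //.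
    by rewrite iter_shift CA gez0_abs ?subr_ge0 // subrKC.
  by exists (ls_class R (((ls_index A).1, m) : I)) => //;
    exists (ls_class R (((ls_index A).1, m) : I)) => //; rewrite lexx.
by split; apply: hull; rewrite // le_max lexx ?orbT.
Qed.

Definition fiber t : set (archClass G) := [set B : archClass G | (ls_index B).1 = t].

Lemma fiber_le s t : class_le (fiber s) (fiber t) <-> (s <= t)%O.
Proof.
split=> [[A <- [B <-]]|]; first by rewrite -(ls_index_le (R := R)) => /lexi_fst.
move=> st; exists (ls_class R ((s, 0) : I)); first by rewrite /fiber /= ls_classK.
exists (ls_class R ((t, 0) : I)); first by rewrite /fiber /= ls_classK.
by rewrite ls_class_le lexi_le st /= lexx implybT.
Qed.

Lemma orbit_quot_type : has_order_type T (orbit_quot z) (@class_le _ _).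
Proof.
exists fiber; split; last exact: fiber_le.
apply/seteqP; split=> [_ [t _ <-]|_ [A _ <-]]; last first.
  by exists (ls_index A).1 => //; rewrite orbit_classE.
by exists (ls_class R ((t, 0) : I)) => //; rewrite orbit_classE ls_classK.
Qed.

(** * Truncations and the coarsenings they define *)

Lemma lstrunc_subproof t f :
  finite_set [set p : I | (if (p.1 < t)%O then f p else 0) != 0].
Proof.
apply: sub_finite_set (@lscoefP _ _ _ f) => p /=.
by case: ifP => // _; rewrite eqxx.
Qed.
(** The kernel is the convex subgroup of the elements that vanish on all fibers below [t]; the image
    realizes the quotient inside [G], so the coarsening again takes values in [G]. *)
Definition lstrunc t f : G := LexSum (@lstrunc_subproof t f).

Lemma lstruncD t : {morph lstrunc t : f g / f + g}.
Proof.
by move=> f g; apply: lexsumP => p /=; case: ifP => // _; rewrite addr0.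
Qed.

Lemma lstrunc_lead t f p : is_lead f p -> (p.1 < t)%O ->
  is_lead (lstrunc t f) p /\ lstrunc t f p = f p.
Proof.
move=> [fp lp] pt; have e : lstrunc t f p = f p by rewrite /= pt.
by split=> //; split=> [|q /lp fq]; rewrite ?e //= fq; case: ifP.
Qed.

Lemma lstrunc_lead0 t f p : is_lead f p -> (t <= p.1)%O -> lstrunc t f = 0.
Proof.
move=> [_ lp] tp; apply: lexsumP => q /=; case: ifP => // qt.
by rewrite lp //; apply/lexi_lt/(lt_le_trans qt).
Qed.

Lemma lstrunc0 t : lstrunc t 0 = 0.
Proof. by apply: lexsumP => p /=; case: ifP. Qed.

Lemma lstrunc_eq0 t f p : is_lead f p -> lstrunc t f = 0 <-> (t <= p.1)%O.
Proof.
move=> lp; split=> [e|]; last exact: lstrunc_lead0.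
rewrite leNgt; apply/negP => /(lstrunc_lead lp) [/lead_neq0].
by rewrite e eqxx.
Qed.

Lemma lstrunc_ge0 t f : 0 <= f -> 0 <= lstrunc t f.
Proof.
rewrite le_eqVlt => /orP[/eqP <-|f0]; first by rewrite lstrunc0 lexx.
have [p lp] : exists p, is_lead f p by apply: lead_ex; rewrite gt_eqF.
have [pt|tp] := ltP p.1 t; last by rewrite (lstrunc_lead0 lp tp) lexx.
have [lt e] := lstrunc_lead lp pt.
by apply: ltW; rewrite (lsgt0_lead lt) e -(lsgt0_lead lp).
Qed.

Lemma lstrunc_le t : {homo lstrunc t : f g / f <= g}.
Proof.
move=> f g fg; have := @lstrunc_ge0 t (g - f); rewrite oag_subr_ge0 => /(_ fg).
by rewrite -(oag_leD2 (lstrunc t f)) -lstruncD subrK add0r.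
Qed.

Definition wtrunc t (a : K) : G := lstrunc t (v a).

Lemma wtrunc_coarsening t : coarsening (wtrunc t).
Proof.
split; [split=> [a b a0 b0|a b a0 b0 ab0]|].
- by rewrite /wtrunc hvalM // lstruncD.
- by rewrite oag_ge_min; have /orP[h|h] := hval_add ab0; apply/orP; [left|right];
    exact: lstrunc_le.
- by move=> a [->|va]; [left|right; exact: lstrunc_ge0].
Qed.

Local Notation h := (ls_cross (I := I) (R := R) shift).
Local Notation l := (ls_log (I := I) (R := R) shift).

Let hmonom1_neq0 g : hmonom 1 g != 0 :> K.
Proof. by apply: hmonom_neq0; rewrite oner_eq0. Qed.

Let hval_monom1 g : v (hmonom 1 g) = g.
Proof. by rewrite hval_monom ?oner_eq0. Qed.

Let l_lead (a : K) p : a != 0 -> is_lead (v a) p ->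
  l a != 0 /\ v (l a) = - lsdelta R (shift p).
Proof. by move=> a0 lp; apply: ls_log_lead; [exact: shift_mono|exact: shift_gt|..]. Qed.

Let l_units : log_units_compatible l v.
Proof. by have [_ []] := ls_log_gives_rise R shift_mono shift_gt. Qed.

(** The leading indices [p] of [v a] and [shift p] of [v (l a)] lie in one fiber, so truncation
    kills both or neither. Since [v (l a)] is negative, [l a] is in the ring exactly when it is
    killed. *)
Lemma wtrunc_units t : log_units_compatible l (wtrunc t).
Proof.
have [_ vw] := wtrunc_coarsening t.
apply/seteqP; split=> [_ [a [a0 wa] <-]|x [lx [a a0 la]]].
  split; last by exists a.
  have [va|va] := eqVneq (v a) 0.
    by apply: vw; have : (l @` pos_units v) (l a) by [exists a]; rewrite l_units => -[].
  have [p lp] := lead_ex va; have [_ vl] := l_lead (lt0r_neq0 a0) lp.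
  right; rewrite /wtrunc vl (lstrunc_lead0 (leadN (lead_delta R _))) //=.
  exact/(lstrunc_eq0 _ lp).
exists a => //; split=> //.
have [va|va] := eqVneq (v a) 0; first by rewrite /wtrunc va lstrunc0.
have [p lp] := lead_ex va; have [l0 vl] := l_lead (lt0r_neq0 a0) lp.
move: lx; rewrite -la => -[/eqP|]; first by rewrite (negbTE l0).
have ld := leadN (lead_delta R (shift p)).
rewrite /wtrunc vl oag_leNgt => w0; apply/(lstrunc_eq0 _ lp).
rewrite leNgt; apply/negP => pt; have [lt e] := lstrunc_lead ld (pt : ((shift p).1 < t)%O).
by move: w0; rewrite (lslt0_lead lt) e lsoppE lsdelta_diag ltrN10.
Qed.

(** For [s <= t], truncation at [s] factors through truncation at [t]. For [t < s], the monomial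
    with exponent [- lsdelta R (t, 0)] lies in the first ring only. *)
Lemma wtrunc_sub s t :
  val_ring (wtrunc t) `<=` val_ring (wtrunc s) <-> (s <= t)%O.
Proof.
split=> [sub|st a [->|wa]]; last 1 first.
- right; suff -> : wtrunc s a = lstrunc s (wtrunc t a) by exact: lstrunc_ge0.
  by apply: lexsumP => p /=; case: ifP => // ps; rewrite (lt_le_trans ps st).
- rewrite leNgt; apply/negP => ts.
  have ld := leadN (lead_delta R ((t, 0) : I)).
  case: (sub (hmonom 1 (- lsdelta R ((t, 0) : I)))).
  + by right; rewrite /wtrunc hval_monom1 (lstrunc_lead0 ld).
  + by move/eqP; rewrite (negbTE (hmonom1_neq0 _)).
  + have [lt e] := lstrunc_lead ld (ts : (((t, 0) : I).1 < s)%O).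
    by rewrite /wtrunc hval_monom1 oag_leNgt (lslt0_lead lt) e lsoppE lsdelta_diag ltrN10.
- by left.
Qed.

Lemma wtrunc_rank t : rank (val_ring (wtrunc t)).
Proof.
exists G, (wtrunc t); split=> //; first exact: wtrunc_coarsening.
pose g : G := - lsdelta R ((t, 0) : I).
have ld : is_lead g (t, 0) := leadN (lead_delta R _).
move=> e; have : val_ring (wtrunc t) (hmonom 1 g).
  by right; rewrite /wtrunc hval_monom1 (lstrunc_lead0 ld).
rewrite e => -[/eqP|]; first by rewrite (negbTE (hmonom1_neq0 _)).
by rewrite hval_monom1 oag_leNgt (lslt0_lead ld) lsoppE lsdelta_diag ltrN10.
Qed.

Lemma hmonom1_gt0 g : 0 < hmonom 1 g :> K.
Proof. exact: hmonom_gt0. Qed.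

(** The units of [wtrunc t] have values with leading indices in fibers from [t] on, so [fiber t] is
    the least class; the monomial with exponent [lsdelta R (t, 0)] attains it. *)
Lemma wtrunc_principal t : principal_exp_rank l z (val_ring (wtrunc t)).
Proof.
have wc := wtrunc_coarsening t.
split; first by split; [exact: wtrunc_rank|exists G, (wtrunc t); split=> //; exact: wtrunc_units].
exists G, (wtrunc t); split=> //; exists (fiber t).
  have ld := lead_delta R ((t, 0) : I).
  exists (hmonom 1 (lsdelta R ((t, 0) : I))), (ls_class R ((t, 0) : I)); split.
  - split=> [|[_]]; last by rewrite hval_monom1 => /eqP; rewrite (negbTE (lead_neq0 ld)).
    by split; [exact: hmonom1_gt0|rewrite /wtrunc hval_monom1 (lstrunc_lead0 ld)].
  - by rewrite hval_monom1; exact: natval_lead.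
  - by rewrite orbit_classE ls_classK.
move=> _ [a [alpha [[[a0 wa] _] na ->]]].
rewrite orbit_classE; apply/fiber_le.
have lp : is_lead (v a) (ls_index alpha) by apply: lead_natval; rewrite ls_indexK.
exact/(lstrunc_eq0 _ lp).
Qed.

(** * Kernels of monotone homomorphisms under the inverse shift *)

Section ConvexKernel.
Variables (H : oagType) (W : G -> H).
Hypothesis WD : {morph W : x y / x + y}.
Hypothesis Wle : {homo W : x y / x <= y}.

Let W0 : W 0 = 0.
Proof. by apply: (addrI (W 0)); rewrite -WD !addr0. Qed.

Let WN x : W (- x) = - W x.
Proof. by apply/eqP; rewrite -addr_eq0 -WD addNr W0. Qed.

(** As [f] does not dominate [g], some [n] gives [|f| <= n |g|], and monotonicity squeezes [W f]
    between two zeros. *)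
Lemma kernel_convex g f p q :
  W g = 0 -> is_lead g p -> is_lead f q -> (p <= q)%O -> W f = 0.
Proof.
move=> Wg lg lf pq.
pose x : nonzero G := exist _ f (lead_neq0 lf).
pose y : nonzero G := exist _ g (lead_neq0 lg).
have /arch_ltNP [n /= fg] : ~ arch_lt x y.
  by move=> /(@arch_lt_lead _ _ _ x y _ _ lf lg); rewrite ltNge pq.
have Wabs : W (oag_abs g) = 0.
  by rewrite /oag_abs /Order.max; case: ifP => _; rewrite ?WN Wg ?oppr0.
have Wn : W (oag_abs g *+ n) = 0.
  by elim: n {fg} => [|n IH]; rewrite ?mulr0n // mulrS WD Wabs IH addr0.
have abs_ge : f <= oag_abs f /\ - f <= oag_abs f.
  rewrite /oag_abs /Order.max; case: ifP => [/ltW|/negbT].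
    by rewrite lexx.
  by rewrite -oag_leNgt lexx.
apply/le_anti; apply/andP; split.
  by rewrite -Wn; apply: Wle; apply: le_trans fg; case: abs_ge.
rewrite -oag_leN oppr0 -WN -Wn; apply: Wle; apply: le_trans fg.
by case: abs_ge.
Qed.

Hypothesis W_shift : forall p, W (lsdelta R (shift p)) = 0 -> W (lsdelta R p) = 0.

(** By [W_shift] the kernel contains the deltas at [(t, n - k)] for all [k]. Taking [k = |n - q.2|]
    gets below [q], and convexity does the rest. *)
Lemma kernel_fiber g t n f q :
  W g = 0 -> is_lead g (t, n) -> is_lead f q -> (t <= q.1)%O -> W f = 0.
Proof.
move=> Wg lg lf tq.
have Wd k : W (lsdelta R ((t, n - k%:Z) : I)) = 0.
  elim: k => [|k IH].
    by rewrite subr0; apply: kernel_convex Wg lg (lead_delta R _) (lexx _).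
  by apply: W_shift; rewrite /shift /= -addn1 PoszD opprD addrA subrK.
apply: (kernel_convex (Wd `|n - q.2|%N) (lead_delta R _) lf).
rewrite lexi_le tq /=; apply/implyP => _.
by rewrite lerBlDr -lerBlDl; exact: lez_abs.
Qed.

End ConvexKernel.

(** * Every member of the principal exponential rank is a truncation ring *)

Lemma principal_wtrunc (S : set K) :
  principal_exp_rank l z S -> exists t, val_ring (wtrunc t) = S.
Proof.
move=> [[_ [H [w [wc lw Sw]]]] [H' [w' [wc' [C0 C0f C0min] Sw']]]].
have [W [WD Wle wW]] := coarsening_factor wc.
have [W' [W'D W'le wW']] := coarsening_factor wc'.
have WNof (X : oagType) (U : G -> X) : {morph U : x y / x + y} ->
    U 0 = 0 /\ forall x, U (- x) = - U x.
  move=> UD; have U0 : U 0 = 0 by apply: (addrI (U 0)); rewrite -UD !addr0.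
  by split=> // x; apply/eqP; rewrite -addr_eq0 -UD addNr U0.
have [W0 WN] := WNof _ _ WD; have [W'0 W'N] := WNof _ _ W'D.
(* Compatibility is known for [w] and the least class for [w']; their common ring [S], tested on
   monomials, transfers signs, and hence kernels, between [W] and [W']. *)
have ge0 g : 0 <= W g <-> 0 <= W' g.
  have m0 := hmonom1_neq0 g.
  have mem (X : oagType) (u : K -> X) (U : G -> X) :
      (forall a, a != 0 -> u a = U (v a)) -> val_ring u (hmonom 1 g) <-> 0 <= U g.
    move=> uU; rewrite /val_ring /= uU // hval_monom1; split=> [[/eqP|//]|]; last by right.
    by rewrite (negbTE m0).
  by rewrite -(mem _ _ _ wW) -(mem _ _ _ wW') -Sw -Sw'.
have ker g : W g = 0 <-> W' g = 0.
  have E (X : oagType) (x : X) : x = 0 <-> 0 <= x /\ 0 <= - x.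
    split=> [->|[x0]]; first by rewrite oppr0 lexx.
    by rewrite -oag_leN opprK oppr0 => x0'; apply/le_anti/andP.
  by rewrite !E -WN -W'N !ge0.
have [a0 [alpha0 [[[a00 wa0] _] na0 C0E]]] := C0f.
set p0 := ls_index alpha0; have lp0 : is_lead (v a0) p0.
  by apply: lead_natval; rewrite ls_indexK.
exists p0.1.
have Wa0 : W (v a0) = 0 by apply/ker; rewrite -wW' ?lt0r_neq0.
(* The value of [l a] is minus the shifted delta, which [W] kills, so [l a] is in the ring of [w].
   Compatibility makes it the logarithm of a unit of [w], which is [a] by injectivity. *)
have W_shift p : W (lsdelta R (shift p)) = 0 -> W (lsdelta R p) = 0.
  move=> Wp; pose a : K := hmonom 1 (lsdelta R p).
  have ap : 0 < a := hmonom1_gt0 _; have an0 : a != 0 := hmonom1_neq0 _.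
  have lv : is_lead (v a) p by rewrite hval_monom1; exact: lead_delta.
  have [l0 vl] := l_lead an0 lv.
  have : (l @` pos_units w) (l a).
    rewrite lw; split; last by exists a.
    by right; rewrite wW // vl WN Wp oppr0.
  move=> [b [b0 wb] /(ls_log_inj shift_mono shift_gt b0 ap) e].
  by rewrite -[lsdelta R p]hval_monom1 -/a -wW // -e.
have Wge f q : is_lead f q -> (p0.1 <= q.1)%O -> W f = 0.
  move=> lf pq; have lp0' : is_lead (v a0) ((p0.1, p0.2) : I).
    by rewrite -surjective_pairing.
  exact: (kernel_fiber WD Wle W_shift Wa0 lp0' lf pq).
(* If [W f = 0], the monomial at [f] is a unit of [w'] but not of [v], so its class is at least
   [C0]. *)
have Wlt f q : is_lead f q -> W f = 0 -> (p0.1 <= q.1)%O.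
  move=> lf /ker W'f.
  have : class_le C0 (orbit_class z (ls_class R q)).
    apply: C0min; exists (hmonom 1 f), (ls_class R q); split=> //.
      split; first by split; [exact: hmonom1_gt0|rewrite (wW' _ (hmonom1_neq0 _)) hval_monom1].
      by move=> [_]; rewrite hval_monom1 => /eqP; rewrite (negbTE (lead_neq0 lf)).
    by rewrite hval_monom1; exact: natval_lead.
  by rewrite C0E !orbit_classE ls_classK => /fiber_le.
rewrite Sw; apply/seteqP; rewrite /val_ring.
suff E a : a != 0 -> 0 <= wtrunc p0.1 a <-> 0 <= w a.
  by split=> a; (have [->|/E e] := eqVneq a 0; first by left);
    case=> [->|/e]; by [left|right].
move=> an0; rewrite wW // /wtrunc; have [->|va] := eqVneq (v a) 0.
  by rewrite lstrunc0 W0 !lexx.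
have [q lq] := lead_ex va; have [qp|pq] := ltP q.1 p0.1; last first.
  by rewrite (lstrunc_lead0 lq pq) (Wge _ _ lq pq) !lexx.
have [lt e] := lstrunc_lead lq qp.
(* Outside the common kernel, [W] and the truncation both preserve the sign of [v a]. *)
have Wn0 : W (v a) != 0 by apply/eqP => /(Wlt _ _ lq); rewrite leNgt qp.
have [vn|vp] := oag_neq0 va.
  have tn : lstrunc p0.1 (v a) < 0 by rewrite (lslt0_lead lt) e -(lslt0_lead lq).
  split=> h0; first by move: h0; rewrite oag_leNgt tn.
  have := Wle _ _ (ltW vn); rewrite W0 => h1.
  by move/eqP: Wn0; case; apply/le_anti/andP.
split=> _; first by rewrite -W0; apply: Wle; exact: ltW.
by apply: lstrunc_ge0; exact: ltW.
Qed.

Lemma principal_exp_rank_type :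
  has_order_type T (principal_exp_rank l z) (fun S S' => S' `<=` S).
Proof.
exists (fun t => val_ring (wtrunc t)); split; last by move=> s t; exact: wtrunc_sub.
apply/seteqP; split=> [_ [t _ <-]|S /principal_wtrunc [t <-]]; last by exists t.
exact: wtrunc_principal.
Qed.

End ShiftedSum.

Theorem theorem20 (R : realType) (d : Order.disp_t) (T : orderType d) :
  exists G : oagType,
    [/\ divisible_group G,
        exists zeta : archClass G -> archClass G,
          [/\ order_automorphism zeta,
              forall alpha, (alpha < zeta alpha)%O
            & has_order_type T (orbit_quot zeta) (@class_le _ _)]
      & exists (h : G -> hahn G R) (l : hahn G R -> hahn G R)
               (zeta_l : archClass G -> archClass G),
          [/\ strong_log_cross_section h,
              gives_rise_to h l,
              strong_log l,
              inhabited T -> log_image l <> setT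
            & is_log_zeta l zeta_l /\
              has_order_type T (principal_exp_rank l zeta_l)
                (fun S S' => S' `<=` S)]].
Proof.
pose sh := @shift d T; have sm := @shift_mono d T; have sg := @shift_gt d T.
exists (lexsum (T *l int)%type R); split; first exact: lexsum_divisible.
  exists (class_shift sh); split; first exact: class_shift_auto.
    exact: class_shift_gt.
  exact: orbit_quot_type.
exists (ls_cross sh), (ls_log sh), (class_shift sh); split.
- exact: ls_cross_section.
- exact: ls_log_gives_rise.
- exact: ls_log_strong.
(* An element [t] supplies the index [(t, 0)]. For empty [T] the field is a copy of [R] and the
   logarithm is [ln], which is onto. *)
- by move=> [t]; apply: ls_log_nonsurj => //; exact: (inhabits (t, 0)).
- by split; [exact: ls_log_zeta|exact: principal_exp_rank_type].
Qed.
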